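(* Let $\alpha>0$, $\beta>0$, $\mu\in\mathbb{R}$, $\sigma>0$, $s>0$, and let $X$ be a random variable having the $\mathrm{BGN}(\alpha,\beta,\mu,\sigma,s)$ distribution. Let $n$ be a positive integer. Then the $n$th moment of $X$ can be expressed as $$ \mathrm{E}(X^n)=\frac{\mu^n}{\mathrm{B}(\alpha,\beta)}\sum_{j=0}^{\infty}(-1)^j\binom{\beta-1}{j}\sum_{i=0}^n\binom{n}{i}\left(\frac{\sigma}{\mu}\right)^i\sum_{k=0}^\infty\left[v_k(j+\alpha-1)+(-1)^{i+k}\binom{j+\alpha-1}{k}\right]J_{i,k}^{(s)}, $$ where, for real $a$ and integers $i,k\ge 0$, $$ v_k(a)=\sum_{m=k}^\infty(-1)^{k+m}\binom{a}{m}\binom{m}{k} \qquad\text{and}\qquad J_{i,k}^{(s)}=\int_0^\infty z^i\,\phi_s(z)\,\Phi_s(z)^k\,\mathrm{d}z . $$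
   Context: For $s>0$, let $\phi_s(z)=\frac{s}{2\Gamma(1/s)}\exp(-|z|^s)$, $z\in\mathbb{R}$, be the standardized generalized normal density, and let $\Phi_s$ be its cumulative distribution function: $\Phi_s(z)=\frac{\Gamma(1/s,(-z)^s)}{2\Gamma(1/s)}$ for $z\le 0$ and $\Phi_s(z)=1-\frac{\Gamma(1/s,z^s)}{2\Gamma(1/s)}$ for $z>0$, where $\Gamma(a,x)=\int_x^\infty t^{a-1}e^{-t}\,\mathrm{d}t$ is the complementary incomplete gamma function and $\Gamma(\cdot)$ is the gamma function. Let $\mathrm{B}(\alpha,\beta)=\Gamma(\alpha)\Gamma(\beta)/\Gamma(\alpha+\beta)$ be the beta function. A random variable $X$ has the beta generalized normal distribution $\mathrm{BGN}(\alpha,\beta,\mu,\sigma,s)$, with $\alpha,\beta,\sigma,s>0$ and $\mu\in\mathbb{R}$, if it has density $$ f(x)=\frac{1}{\sigma\,\mathrm{B}(\alpha,\beta)}\left[\Phi_s\left(\frac{x-\mu}{\sigma}\right)\right]^{\alpha-1}\left[1-\Phi_s\left(\frac{x-\mu}{\sigma}\right)\right]^{\beta-1}\phi_s\left(\frac{x-\mu}{\sigma}\right),\quad x\in\mathbb{R}. $$ For real $a$ and integer $m\ge 0$, $\binom{a}{m}=\frac{a(a-1)\cdots(a-m+1)}{m!}$ is the generalized binomial coefficient.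
   Formalization: Assumes μ≠0, as σ/μ occurs. For non-integer α the series v_k diverge, so the displayed formula is stated only when every v_k(j+α−1) converges (integer α); for all α>0 it is stated with the sums over k and m truncated at the same M, M→∞. *)

(* Defs.v *)
From HB Require Import structures.
From mathcomp Require Import all_boot all_order all_algebra.
From mathcomp Require Import all_classical all_reals all_analysis.

Set Implicit Arguments.
Unset Strict Implicit.
Unset Printing Implicit Defensive.

Import Order.TTheory GRing.Theory Num.Theory.
Import numFieldNormedType.Exports.

Local Open Scope classical_set_scope.
Local Open Scope ring_scope.

Section special_functions.
Context {R : realType}.
Implicit Types a b s x z : R.

Local Notation leb := (@lebesgue_measure R).

Definition upper_gamma a x : R :=
  \int[leb]_(t in `[x, +oo[) (t `^ (a - 1) * expR (- t)).

Definition gamma a : R := upper_gamma a 0.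

Definition beta a b : R := gamma a * gamma b / gamma (a + b).

Definition gbinom a (m : nat) : R := (\prod_(i < m) (a - i%:R)) / m`!%:R.

Definition gn_pdf s z : R := s / (2 * gamma s^-1) * expR (- (`|z| `^ s)).

Definition gn_cdf s z : R :=
  if z <= 0 then upper_gamma s^-1 ((- z) `^ s) / (2 * gamma s^-1)
  else 1 - upper_gamma s^-1 (z `^ s) / (2 * gamma s^-1).

Definition bgn_pdf alpha bet mu sigma s x : R :=
  (sigma * beta alpha bet)^-1
  * gn_cdf s ((x - mu) / sigma) `^ (alpha - 1)
  * (1 - gn_cdf s ((x - mu) / sigma)) `^ (bet - 1)
  * gn_pdf s ((x - mu) / sigma).

Definition J s (i k : nat) : R :=
  \int[leb]_(z in `[0, +oo[) (z ^+ i * gn_pdf s z * gn_cdf s z ^+ k).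

Definition v_part a (k : nat) : R^nat := fun M =>
  \sum_(k <= m < M) (-1) ^+ (k + m) * gbinom a m * 'C(m, k)%:R.

(* The series defining [v a k] diverges when a is not a natural number and
   k > a; [limn] is then a junk value, so uses of [v] must come with
   [cvgn (v_part a k)]. *)
Definition v a (k : nat) : R := limn (v_part a k).

(* Partial sums of the series over k, each [v a k] being itself the sum of a
   series. *)
Definition inner_iterated s (i : nat) a : R^nat := fun M =>
  \sum_(0 <= k < M) (v a k + (-1) ^+ (i + k) * gbinom a k) * J s i k.

(* Same double series over k <= m, with the summations over k and over m
   truncated at the same rank M; this makes sense for every a > -1. *)
Definition inner_joint s (i : nat) a : R^nat := fun M =>
  \sum_(0 <= k < M) (v_part a k M + (-1) ^+ (i + k) * gbinom a k) * J s i k.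

(* Partial sums of the series over j; [S i a] is the sequence of partial sums
   chosen for the inner series over k. *)
Definition outer (S : nat -> R -> R^nat) alpha bet mu sigma (n : nat) : R^nat :=
  fun N => \sum_(0 <= j < N) (-1) ^+ j * gbinom (bet - 1) j *
    \sum_(0 <= i < n.+1) 'C(n, i)%:R * (sigma / mu) ^+ i *
      limn (S i (j%:R + alpha - 1)).

End special_functions.

Definition has_density (R : realType) (d : measure_display)
    (T : measurableType d) (P : probability T R) (X : {RV P >-> R})
    (f : R -> R) : Prop :=
  forall A : set R, measurable A ->
    distribution P X A = (\int[@lebesgue_measure R]_(x in A) (f x)%:E)%E.

(* The n-th moment is mu^n / B(alpha, bet) times the sum of [outer S], all the
   series involved being convergent. *)
Definition moment_expansion (R : realType) (d : measure_display)
    (T : measurableType d) (P : probability T R) (X : {RV P >-> R})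
    (S : nat -> R -> R^nat) (alpha bet mu sigma : R) (n : nat) : Prop :=
  [/\ forall i j : nat, (i <= n)%N -> cvgn (S i (j%:R + alpha - 1)),
      cvgn (outer S alpha bet mu sigma n) &
      ('E_P[fun w => (X w ^+ n)%R])%E =
        (mu ^+ n / beta alpha bet * limn (outer S alpha bet mu sigma n))%:E].

(* Main.v *)
From HB Require Import structures.
Require Import Defs.
From mathcomp Require Import all_boot all_order all_algebra.
From mathcomp Require Import all_classical all_reals all_analysis.
From mathcomp Require Import measurable_realfun.
From mathcomp Require Import ring lra.
Import Order.TTheory GRing.Theory Num.Theory.
Import numFieldNormedType.Exports.
Local Open Scope classical_set_scope.
Local Open Scope ring_scope.
Set Implicit Arguments.
Unset Strict Implicit.
Unset Printing Implicit Defensive.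

(** Substituting [x = mu + sigma z] and expanding [(mu + sigma z) ^+ n] writes
    the moment as a finite combination of the probability-weighted moments
    M_i(a, b), the integral over the line of z^i phi(z) Phi(z)^a (1 - Phi(z))^b,
    at [a = alpha - 1] and [b = bet - 1] ([bgn_moment]). Three binomial series
    then give the formula.

    The series over [j] expands (1 - Phi)^(bet - 1) in powers of Phi and reduces
    to the moments M_i(j + alpha - 1, 0) ([cvg_pq_moment_pow]). In each of them
    the line is folded onto the positive half-line by the symmetry
    Phi(-z) = 1 - Phi(z), which leaves Phi^a + (-1)^i (1 - Phi)^a. The second
    term is expanded in powers of Phi, with integrals [J s i k]; the first one is
    expanded in powers of 1 - Phi, and each (1 - Phi)^m is expanded by the finite
    binomial theorem, which after exchanging the order of summation produces the
    coefficients [v_part] ([cvg_pq_moment], [inner_jointE]).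

    Every termwise integration is an instance of [cvg_abinom_integral], that is,
    of dominated convergence. The domination rests on the fact that the
    coefficients of (1 - u)^b have eventually constant sign, so that the partial
    sums are bounded on [0, 1) by a constant plus the sum (1 - u)^b
    ([abinom_sum_bound]). It remains to see that z^i phi Phi^a (1 - Phi)^b is
    integrable for a, b > -1 ([integrable_gn_weight]): if y = |z|^s, the tail of
    Phi is at least a multiple of exp(-y) / (y + 2), so a power of it with
    exponent larger than -1 cannot cancel the decay exp(-y) of phi.

    When the coefficients [v] are themselves defined by convergent series, the
    exponents are natural numbers ([cvg_v_part_natural]). All the inner sums are
    then finite, and summing iteratively or jointly gives the same result
    ([inner_iterated_joint]). *)

(** * The binomial series and a uniform bound on its partial sums *)

Section binomial_series.
Context {R : realType}.
Implicit Types b u x : R.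

(** Coefficient of [u ^+ j] in the expansion of [(1 - u) `^ b]; the alternating
    sign is absorbed so that the coefficients eventually have constant sign. *)
Definition abinom b (j : nat) : R := (-1) ^+ j * gbinom b j.

Lemma gbinomS b j : gbinom b j.+1 * j.+1%:R = gbinom b j * (b - j%:R).
Proof.
rewrite /gbinom big_ord_recr/= factS natrM.
have h1 : (j`!)%:R != 0 :> R by rewrite pnatr_eq0 -lt0n fact_gt0.
have h2 : (j.+1)%:R != 0 :> R by rewrite pnatr_eq0.
by field; rewrite h1/=.
Qed.

Lemma abinomS b j : abinom b j.+1 * j.+1%:R = abinom b j * (j%:R - b).
Proof. by rewrite /abinom -mulrA gbinomS exprS; ring. Qed.

Lemma abinom0 b : abinom b 0 = 1.
Proof. by rewrite /abinom /gbinom big_ord0 fact0 expr0 mul1r divr1. Qed.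

Definition abinom_sum b (N : nat) u : R := \sum_(0 <= j < N) abinom b j * u ^+ j.

Lemma abinom_sumS b N u :
  abinom_sum b N.+1 u = abinom_sum b N u + abinom b N * u ^+ N.
Proof. by rewrite /abinom_sum big_nat_recr. Qed.

(** The recurrence [abinomS] makes the partial sums satisfy the differential
    equation [(1 - u) y' + b y = 0] of [(1 - u) `^ b] up to a single monomial. *)
Lemma is_derive_abinom_sum b N u : u < 1 ->
  is_derive u 1 (abinom_sum b N)
    ((- (N%:R * abinom b N * u ^+ N.-1) - b * abinom_sum b N u) / (1 - u)).
Proof.
move=> u1; have u1N : 1 - u != 0 by lra.
elim: N => [|N IH].
  rewrite (_ : abinom_sum b 0 = cst 0); last first.
    by apply/funext => x; rewrite /abinom_sum big_nil.
  by apply: is_derive_eq; rewrite /cst !mul0r mulr0 subr0 oppr0 mul0r.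
rewrite (_ : abinom_sum b N.+1 =
    abinom_sum b N + (cst (abinom b N) * (fun x => x ^+ N))); last first.
  by apply/funext => x; rewrite abinom_sumS.
have HX : is_derive u 1 (fun x : R => x ^+ N) (N%:R * u ^+ N.-1).
  by apply: DeriveDef; [exact: exprn_derivable|rewrite exp_derive [LHS]mulr1].
have HM := @is_deriveM _ _ _ _ _ _ _ _ (is_derive_cst (abinom b N) u 1) HX.
apply: (@is_derive_eq _ _ _ _ _ _ _ _ (is_deriveD IH HM)).
transitivity ((- (N%:R * abinom b N * u ^+ N.-1) - b * abinom_sum b N u) /
    (1 - u) + abinom b N * (N%:R * u ^+ N.-1) : R).
  by rewrite scaler0 addr0.
transitivity ((- (N.+1%:R * abinom b N.+1 * u ^+ N) -
    b * (abinom_sum b N u + abinom b N * u ^+ N)) / (1 - u) : R); last by [].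
have -> : N.+1%:R * abinom b N.+1 * u ^+ N =
  abinom b N * (N%:R - b) * u ^+ N by rewrite -abinomS; ring.
case: N {IH HX HM} => [|N]; rewrite [_.-1]/= ?exprS ?expr0; field; exact: u1N.
Qed.

(** By the differential equation, the derivative of the partial sum times
    [(1 - u) `^ (- b)] is the error monomial alone; the mean value theorem on
    [0, x] turns this into a closed form of the remainder. The term
    [(0 < N)%:R] is the value of the partial sum at 0: the constant term 1,
    unless the sum is empty. *)
Lemma abinom_sum_remainder b N x : 0 < x < 1 -> exists2 y, 0 < y < x &
  abinom_sum b N x * (1 - x) `^ (- b) - (0 < N)%:R =
  - (N%:R * abinom b N * y ^+ N.-1) * (1 - y) `^ (- b - 1) * x.
Proof.
move=> /andP[x0 x1].
pose f (y : R) : R := abinom_sum b N y * (1 - y) `^ (- b).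
pose df (y : R) : R := - (N%:R * abinom b N * y ^+ N.-1) * (1 - y) `^ (- b - 1).
have dF (y : R) : y < 1 -> is_derive y 1 f (df y).
  move=> y1; have y1N : 1 - y != 0 by lra.
  have y1p : 0 < 1 - y by lra.
  have H1 := is_derive_abinom_sum b N y1.
  have H2 : is_derive y 1 (fun y : R => (1 - y) `^ (- b))
      ((- b * (1 - y) `^ (- b - 1)) * (- 1)).
    have H3 : is_derive y 1 (fun y : R => 1 - y) (-1).
      by apply: is_derive_eq; rewrite add0r mul1r.
    have H4 := is_derive1_powR (- b) y1p.
    exact: (@is_derive1_comp _ (fun z : R => z `^ (- b)) (fun y : R => 1 - y) y _ _ H4 H3).
  have H5 := @is_deriveM _ _ (abinom_sum b N) (fun y : R => (1 - y) `^ (- b)) y 1 _ _ H1 H2.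
  apply: (@is_derive_eq _ _ _ _ _ _ _ _ H5).
  rewrite /GRing.scale/= /df.
  have -> : (1 - y) `^ (- b) = (1 - y) `^ (- b - 1) * (1 - y).
    rewrite -{3}(@powRr1 _ (1 - y)) ?(ltW y1p)// -powRD; last by rewrite y1N implybT.
    by rewrite subrK.
  by field; exact: y1N.
have cf : {within `[0, x], continuous f}.
  apply: derivable_within_continuous => y; rewrite in_itv/= => /andP[y0 yx].
  have [] // := dF y _; lra.
have H : forall y : R, y \in `]0, x[ -> is_derive y 1 f (df y).
  by move=> y; rewrite in_itv/= => /andP[y0 yx]; apply: dF; lra.
have [y yI] := MVT x0 H cf.
move: yI; rewrite in_itv/= => yI; rewrite subr0 => e.
exists y => //; rewrite -/(f x) -[RHS]e; congr (_ - _).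
rewrite /f subr0 powR1 mulr1 /abinom_sum.
case: N {f df dF cf H e} => [|N]; first by rewrite big_nil.
rewrite big_nat_recl// abinom0 expr0 mulr1 big1 ?addr0// => i _.
by rewrite exprS mul0r mulr0.
Qed.

Lemma geometric_cvg0 (t : R^nat) (y : R) (N0 : nat) : 0 <= y < 1 ->
  (forall n, (N0 <= n)%N -> `|t n.+1| <= y * `|t n|) -> t @ \oo --> (0 : R).
Proof.
move=> /andP[y0 y1] tS.
rewrite -(cvg_shiftn N0).
have bnd n : `|t (n + N0)%N| <= `|t N0| * y ^+ n.
  elim: n => [|n IH]; first by rewrite expr0 mulr1 add0n.
  rewrite addSn (le_trans (tS _ _)) ?leq_addl// exprS mulrCA.
  by rewrite ler_wpM2l.
apply/cvgr0Pnorm_le => e e0.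
have H : (fun n => `|t N0| * y ^+ n) @ \oo --> (0 : R).
  rewrite -[0 as X in _ --> X](mulr0 `|t N0|); apply: cvgMl_tmp.
  by apply: cvg_expr; rewrite ger0_norm.
move/cvgr0_norm_le : H => /(_ e e0); apply: filterS => n h.
by rewrite (le_trans (bnd n))// (le_trans (ler_norm _)).
Qed.

(** Consecutive terms have ratio [(n - b) x / n], which tends to [x < 1]. *)
Lemma abinom_remainder_cvg0 b x : 0 <= x < 1 ->
  (fun N => N%:R * abinom b N * x ^+ N.-1) @ \oo --> (0 : R).
Proof.
move=> /andP[x0 x1].
(* any ratio strictly between x and 1 would do *)
pose y := (1 + x) / 2.
have y01 : 0 <= y < 1 by rewrite /y; lra.
have yx : 0 < y - x by rewrite /y; lra.
apply: (@geometric_cvg0 _ y (Num.truncn (`|b| * x / (y - x))).+2) => // n nb.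
case: n nb => [//|n nb].
rewrite [X in `|X|](_ : _ = (n.+1%:R - b) * x / n.+1%:R *
    (n.+1%:R * abinom b n.+1 * x ^+ n)); last first.
  have h2 : (n.+1)%:R != 0 :> R by rewrite pnatr_eq0.
  rewrite /= exprS (mulrC n.+2%:R) abinomS.
  by move: h2; set k : R := n.+1%:R => h2; field.
rewrite normrM ler_wpM2r// normrM normfV normr_nat ler_pdivrMr ?ltr0n//.
rewrite normrM (ger0_norm x0).
have H1 : `|n.+1%:R - b| <= n.+1%:R + `|b|.
  by rewrite (le_trans (ler_normB _ _))// normr_nat.
apply: (le_trans (ler_wpM2r x0 H1)).
have : `|b| * x / (y - x) <= n.+1%:R.
  rewrite ltW// (lt_le_trans (truncnS_gt _))// ler_nat.
  by apply: leq_trans nb.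
rewrite ler_pdivrMr// => H2; lra.
Qed.

Lemma cvg_abinom_sum b x : 0 <= x < 1 ->
  abinom_sum b ^~ x @ \oo --> (1 - x) `^ b.
Proof.
move=> /andP[x0 x1].
move: x0; rewrite le_eqVlt => /orP[/eqP<-|x0].
  rewrite subr0 powR1; apply: cvg_near_cst.
  exists 1%N => // -[//|N] _ /=; rewrite /abinom_sum big_nat_recl// abinom0.
  by rewrite expr0 mulr1 big1 ?addr0// => i _; rewrite exprS mul0r mulr0.
have x1p : 0 < 1 - x by lra.
have x1N : 1 - x != 0 by lra.
(* K bounds (1 - y)^(-b-1) for y in [0, x], whatever the sign of the exponent *)
pose K : R := 1 + (1 - x) `^ (- b - 1).
have K0 : 0 <= K by rewrite /K addr_ge0 ?powR_ge0.
suff H : (fun N => abinom_sum b N x * (1 - x) `^ (- b)) @ \oo --> (1 : R).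
  have H' := cvgMr_tmp (b := (1 - x) `^ b) H; rewrite mul1r in H'.
  suff -> : abinom_sum b ^~ x = fun N : nat =>
    abinom_sum b N x * (1 - x) `^ (- b) * (1 - x) `^ b by exact: H'.
  apply/funext => N; rewrite -mulrA -powRD ?addNr ?powRr0 ?mulr1//.
  by rewrite x1N implybT.
apply/cvgrPdist_le => e e0.
have x01 : 0 <= x < 1 by lra.
have H0 : (fun N => N%:R * abinom b N * x ^+ N.-1 * (K * x)) @ \oo --> (0 : R).
  rewrite -[X in _ --> X](mul0r (K * x)).
  by apply: cvgMr_tmp; exact: abinom_remainder_cvg0.
move/cvgr0_norm_le : H0 => /(_ e e0) H0.
near=> N.
have N0 : (0 < N)%N by near: N; exists 1%N.
have x01' : 0 < x < 1 by lra.
have [y /andP[y0 yx]] := abinom_sum_remainder b N x01'.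
rewrite N0 /= => E; rewrite distrC E -mulrA.
have : `|N%:R * abinom b N * x ^+ N.-1 * (K * x)| <= e by near: N.
apply: le_trans; rewrite normrM normrN [leRHS]normrM ler_pM//.
  rewrite !normrM ler_wpM2l// !ger0_norm ?exprn_ge0 ?(ltW y0) ?(ltW x0)//.
  by apply: lerXn2r; rewrite ?nnegrE ?(ltW y0) ?(ltW x0)// ltW.
rewrite !normrM ler_wpM2r// (ger0_norm K0) ger0_norm ?powR_ge0// /K.
have [b1|b1] := leP 0 (- b - 1).
  rewrite (@le_trans _ _ 1) ?lerDl ?powR_ge0//.
  apply: (@le_trans _ _ (1 `^ (- b - 1))); last by rewrite powR1.
  by rewrite ge0_ler_powR// ?nnegrE//; lra.
rewrite (@le_trans _ _ ((1 - x) `^ (- b - 1))) ?lerDr//.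
have -> : - b - 1 = - (b + 1) by lra.
rewrite !powRN lef_pV2 ?posrE ?powR_gt0//; [|lra].
by rewrite ge0_ler_powR// ?nnegrE//; lra.
Unshelve. all: by end_near. Qed.

(** This is the domination that allows termwise integration. From the rank
    [N0] on, which exceeds [|b|], the coefficients have constant sign; hence
    the partial sums are monotone and trapped between the [N0]-th one and their
    limit [(1 - x) `^ b]. When [b < 0] the limit is unbounded, so a constant
    alone could not dominate. *)
Lemma abinom_sum_bound b : exists2 C : R, 0 <= C &
  forall N x, 0 <= x < 1 -> `|abinom_sum b N x| <= C + (1 - x) `^ b.
Proof.
pose N0 := (Num.truncn `|b|).+1.
have sgn : exists2 e : R, `|e| = 1 & forall j, (N0 <= j)%N -> 0 <= e * abinom b j.
  exists (if 0 <= abinom b N0 then 1 else -1).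
    by case: ifP => _; rewrite ?normrN normr1.
  move=> j; elim: j => [|j IH].
    by rewrite /N0.
  rewrite leq_eqVlt => /orP[/eqP <-|].
    case: ifPn; first by rewrite mul1r.
    by rewrite -ltNge mulN1r oppr_ge0 => /ltW.
  rewrite ltnS => N0j; move: (IH N0j); set e := (if _ then _ else _) => h.
  have j0 : 0 < j.+1%:R :> R by rewrite ltr0n.
  rewrite -(pmulr_lge0 _ j0) -mulrA abinomS mulrA mulr_ge0// subr_ge0.
  rewrite (le_trans (ler_norm _))// ltW// (lt_le_trans (truncnS_gt _))//.
  by rewrite ler_nat.
have [e e1 es] := sgn.
pose C0 : R := \sum_(0 <= j < N0) `|abinom b j|.
have C0N N x : 0 <= x < 1 -> (N <= N0)%N -> `|abinom_sum b N x| <= C0.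
  move=> /andP[x0 x1] NN0; rewrite /abinom_sum.
  rewrite (le_trans (ler_norm_sum _ _ _))//.
  apply: (@le_trans _ _ (\sum_(0 <= j < N) `|abinom b j|)).
    apply: ler_sum => j _; rewrite normrM ler_piMr// ger0_norm ?exprn_ge0//.
    by rewrite exprn_ile1// ltW.
  rewrite /C0 [leRHS](big_cat_nat (n := N))//.
  by apply: ler_wpDr; first exact: sumr_ge0.
have C00 : 0 <= C0 by rewrite /C0 sumr_ge0.
exists (C0 + C0); first lra.
move=> N x x01.
have [NN0|/ltnW NN0] := leqP N N0.
  by have := C0N N x x01 NN0; have := powR_ge0 (1 - x) b; lra.
have nd m n : (N0 <= m)%N -> (m <= n)%N ->
    e * abinom_sum b m x <= e * abinom_sum b n x.
  move=> N0m; elim: n => [|n IH]; first by rewrite leqn0 => /eqP ->.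
  rewrite leq_eqVlt => /orP[/eqP ->//|]; rewrite ltnS => mn.
  rewrite (le_trans (IH mn))// abinom_sumS mulrDr lerDl mulrA.
  have /andP[x0 _] := x01.
  by rewrite mulr_ge0 ?exprn_ge0// es// (leq_trans N0m).
have lim : e * abinom_sum b N x <= e * (1 - x) `^ b.
  have H : (fun n => e * abinom_sum b n x) @ \oo --> e * (1 - x) `^ b.
    by apply: cvgMl_tmp; exact: cvg_abinom_sum.
  apply: (cvgr_to_ge H).
  by exists N => // n /= Nn; exact: nd.
have eP y : `|e * y| = `|y| by rewrite normrM e1 mul1r.
have p0 := powR_ge0 (1 - x) b.
have := C0N N0 x x01 (leqnn _).
rewrite -(eP (abinom_sum b N x)) -(eP (abinom_sum b N0 x)) !ler_norml.
move=> /andP[l1 _]; apply/andP; split.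
  by have := nd _ _ (leqnn N0) NN0; lra.
rewrite (le_trans lim)// (le_trans (ler_norm _))// eP ger0_norm//; lra.
Qed.
End binomial_series.

(** * Expectation of a function of a random variable with a density *)

Section measure_tools.
Local Open Scope ereal_scope.

(** By uniqueness, the density agrees almost everywhere with the Radon-Nikodym
    derivative, for which the change of variables holds. *)
Lemma ge0_integral_density (d : measure_display) (T : measurableType d)
    (R : realType) (nu : {finite_measure set T -> \bar R})
    (mu : {sigma_finite_measure set T -> \bar R}) (f : T -> R)
    (g : T -> \bar R) :
  (forall A, measurable A -> nu A = \int[mu]_(x in A) (f x)%:E) ->
  measurable_fun [set: T] f ->
  (forall x, 0 <= g x) -> measurable_fun [set: T] g ->
  \int[nu]_w g w = \int[mu]_x (g x * (f x)%:E).
Proof.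
move=> nuf mf g0 mg.
have mEf : measurable_fun [set: T] (EFin \o f) by exact/measurable_EFinP.
have dom : nu `<< mu.
  apply/null_content_dominatesP => A mA A0; rewrite (nuf A mA).
  by apply: null_set_integral => //; exact: measurable_funTS mEf.
rewrite -(Radon_Nikodym_SigmaFinite.change_of_variables dom)//.
apply: ae_eq_integral => //.
- apply: emeasurable_funM => //.
  exact: (measurable_int mu (Radon_Nikodym_SigmaFinite.f_integrable dom)).
- by apply: emeasurable_funM => //; exact: mEf.
apply: ae_eqe_mul2l.
apply: integral_ae_eq => //.
- exact: Radon_Nikodym_SigmaFinite.f_integrable.
- move=> E _ mE; rewrite -(Radon_Nikodym_SigmaFinite.f_integral dom)//.
  exact: nuf.
Qed.

Lemma integral_density (d : measure_display) (T : measurableType d)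
    (R : realType) (nu : {finite_measure set T -> \bar R})
    (mu : {sigma_finite_measure set T -> \bar R}) (f g : T -> R) :
  (forall A, measurable A -> nu A = \int[mu]_(x in A) (f x)%:E) ->
  (forall x, (0 <= f x)%R) -> measurable_fun [set: T] f ->
  measurable_fun [set: T] g ->
  \int[nu]_w (g w)%:E = \int[mu]_x (g x * f x)%:E.
Proof.
move=> nuf f0 mf mg.
have mEg : measurable_fun [set: T] (EFin \o g) by exact/measurable_EFinP.
rewrite integralE [RHS]integralE; congr (_ - _).
- rewrite (ge0_integral_density nuf)//; last exact: measurable_funepos.
  apply: eq_integral => x _; rewrite !funeposE EFinM.
  by rewrite ![_ * (f x)%:E]muleC maxe_pMr ?lee_fin// mule0.
- rewrite (ge0_integral_density nuf)//; last exact: measurable_funeneg.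
  apply: eq_integral => x _; rewrite !funenegE EFinM.
  by rewrite ![_ * (f x)%:E]muleC -muleN maxe_pMr ?lee_fin// mule0.
Qed.

Lemma expectation_density (R : realType) (d : measure_display)
    (T : measurableType d) (P : probability T R) (X : {RV P >-> R})
    (f g : R -> R) :
  has_density X f -> (forall x, (0 <= f x)%R) ->
  measurable_fun [set: R] f -> measurable_fun [set: R] g ->
  (@lebesgue_measure R).-integrable [set: R] (fun x => (g x * f x)%:E) ->
  'E_P[fun w => g (X w)] = \int[@lebesgue_measure R]_x (g x * f x)%:E.
Proof.
move=> Xf f0 mf mg igf.
(* The Borel sets of R carry two displays: random variables take values in one
   copy of R and Lebesgue measure lives on the other. X is moved to the latter. *)
pose T' : measurableType _ := measurableTypeR R.
pose mu : {sigma_finite_measure set T' -> \bar R} := @lebesgue_measure R.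
have mX : measurable_fun [set: T] (X : T -> T') := measurable_funPT X.
pose X' : {mfun T >-> T'} := HB.pack (X : T -> T')
  (isMeasurableFun.Build _ _ _ _ _ mX).
have nuf (A : set T') : measurable A ->
  distribution P X' A = \int[mu]_(x in A) (f x)%:E by exact: Xf.
have mEg : measurable_fun [set: T'] (EFin \o g) by exact/measurable_EFinP.
have iX : P.-integrable [set: T] (EFin \o g \o X').
  apply/integrableP; split => /=; first exact: measurableT_comp.
  rewrite -(@ge0_integral_distribution _ _ _ _ _ P X' (fun x => `|(g x)%:E|))//; last first.
    exact: measurableT_comp.
  rewrite (ge0_integral_density (mu := mu) (f := f))//; last exact: measurableT_comp.
  move/integrableP : igf => [_]; congr (_ < +oo).
  apply: eq_integral => x _.
  by rewrite EFinM abseM (gee0_abs (x := (f x)%:E)) ?lee_fin.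
rewrite unlock -[LHS](integral_distribution mEg iX).
exact: (@integral_density _ T' R _ mu f g).
Qed.

End measure_tools.

(** * Affine substitutions in Lebesgue integrals *)

Section lebesgue_tools.
Context {R : realType}.
Local Notation leb := (@lebesgue_measure R).
Local Open Scope ereal_scope.

(** Lebesgue measure is determined by its values on half-open intervals, where
    scaling by [s] is visible; a negative [s] swaps the open and closed ends. *)
Lemma lebesgue_measure_affine (c s : R) (s0 : s != 0%R) (A : set R) :
  measurable A ->
  leb A = `|s|%:E * pushforward leb ((fun z => c + s * z)%R : _ -> measurableTypeR R) A.
Proof.
move=> mA.
have ms0 : (0 <= `|s|)%R by [].
have mpsi : measurable_fun [set: measurableTypeR R]
    ((fun z => c + s * z)%R : measurableTypeR R -> measurableTypeR R).
  by apply: measurable_funD => //; exact: measurable_funM.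
pose nu :
    {measure set (measurableTypeR R) -> \bar R} := pushforward leb
  ((fun z => c + s * z)%R : measurableTypeR R -> measurableTypeR R).
pose m := mscale (NngNum ms0) (nu mpsi).
rewrite (@lebesgue_measure_unique R m)// => _ [[a b]] _ <-.
rewrite -[RHS]/(`|s|%:E * leb ((fun z => c + s * z)%R @^-1` `]a, b]%classic)).
rewrite [LHS]/=.
have [s_gt0|s_lt0|/eqP] := ltgtP 0%R s; last by rewrite eq_sym (negbTE s0).
- rewrite (_ : _ @^-1` _ = `](a - c) / s, (b - c) / s]%classic)%R; last first.
    apply/seteqP; split => z /=; rewrite !in_itv/= ltr_pdivrMr// ler_pdivlMr//;
    by rewrite ltrBlDl lerBrDl (mulrC z).
  rewrite !lebesgue_measure_itv/= !lte_fin ltr_pM2r ?invr_gt0// ltrD2r.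
  case: ifPn => // _; last by rewrite mule0.
  by rewrite -EFinB -EFinM (gtr0_norm s_gt0); congr EFin; field.
- rewrite (_ : _ @^-1` _ = `[(b - c) / s, (a - c) / s[%classic)%R; last first.
    apply/seteqP; split => z /=; rewrite !in_itv/= ltr_ndivlMr// ler_ndivrMr//;
    by rewrite ltrBlDl lerBrDl (mulrC z) andbC.
  rewrite !lebesgue_measure_itv/= !lte_fin ltr_nM2r ?invr_lt0// ltrD2r.
  case: ifPn => // _; last by rewrite mule0.
  by rewrite -EFinB -EFinM (ltr0_norm s_lt0); congr EFin; field.
Qed.

Lemma ge0_integral_affine (c s : R) (g : R -> \bar R) : s != 0%R ->
  measurable_fun [set: R] g -> (forall x, 0 <= g x) ->
  \int[leb]_x g x = `|s|%:E * \int[leb]_z g (c + s * z)%R.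
Proof.
move=> s0 mg g0.
have ms0 : (0 <= `|s|)%R by [].
have mpsi : measurable_fun [set: measurableTypeR R]
    ((fun z => c + s * z)%R : measurableTypeR R -> measurableTypeR R).
  by apply: measurable_funD => //; exact: measurable_funM.
pose nu :
    {measure set (measurableTypeR R) -> \bar R} := pushforward leb
  ((fun z => c + s * z)%R : measurableTypeR R -> measurableTypeR R).
rewrite (@eq_measure_integral _ _ _ _ (mscale (NngNum ms0) (nu mpsi))); last first.
  by move=> A mA _; exact: (lebesgue_measure_affine c s0 mA).
rewrite ge0_integral_mscale//.
by rewrite ge0_integral_pushforward.
Qed.

Lemma integrable_affine (c s : R) (g : R -> R) : s != 0%R ->
  measurable_fun [set: R] g ->
  leb.-integrable [set: R] (fun z => (g (c + s * z)%R)%:E) ->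
  leb.-integrable [set: R] (EFin \o g).
Proof.
move=> s0 mg /integrableP[_ ig].
have mEg : measurable_fun [set: R] (EFin \o g) by exact/measurable_EFinP.
apply/integrableP; split; first exact: mEg.
rewrite (@ge0_integral_affine c s)//; last exact: measurableT_comp.
by rewrite lte_mul_pinfty.
Qed.

Lemma integral_affine (c s : R) (g : R -> R) : s != 0%R ->
  measurable_fun [set: R] g ->
  leb.-integrable [set: R] (fun z => (g (c + s * z)%R)%:E) ->
  \int[leb]_x (g x)%:E = `|s|%:E * \int[leb]_z (g (c + s * z)%R)%:E.
Proof.
move=> s0 mg ig.
have mEg : measurable_fun [set: R] (EFin \o g) by exact/measurable_EFinP.
rewrite integralE [X in _ * X]integralE muleBr//; last exact: integrable_add_def.
rewrite (funepos_comp (EFin \o g) (fun z => c + s * z)%R).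
rewrite (funeneg_comp (EFin \o g) (fun z => c + s * z)%R).
rewrite (@ge0_integral_affine c s _ s0 (measurable_funepos mEg))//.
by rewrite (@ge0_integral_affine c s _ s0 (measurable_funeneg mEg)).
Qed.

Local Close Scope ereal_scope.

(** Folding the negative half-line by the affine substitution [z = - y]. *)
Lemma Rintegral_fold (g : R -> R) : leb.-integrable [set: R] (EFin \o g) ->
  \int[leb]_x g x = \int[leb]_(z in `[0, +oo[) (g z + g (- z)).
Proof.
move=> ig.
have mEg := measurable_int leb ig.
have mg : measurable_fun [set: R] g by exact/measurable_EFinP.
have igN : leb.-integrable [set: R] (EFin \o (fun z => g (- z))).
  apply: (@integrable_affine 0 (-1)); first by rewrite oppr_eq0 oner_eq0.
    exact: measurableT_comp.
  apply: eq_integrable ig => // z _.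
  by rewrite /= add0r mulN1r opprK.
have mp : measurable (`[0%R, +oo[%classic : set R) by exact: measurable_itv.
have mp' : measurable (`]0%R, +oo[%classic : set R) by exact: measurable_itv.
have mn : measurable (`]-oo, 0%R[%classic : set R) by exact: measurable_itv.
have memN (z : R) : (- z \in (`]-oo, 0%R[%classic : set R)) =
    (z \in (`]0%R, +oo[%classic : set R)).
  by rewrite !mem_setE !in_itv/= andbT oppr_lt0.
rewrite RintegralD//=; [|exact: integrableS ig|exact: integrableS igN].
have <- : `]-oo, 0%R[ `|` `[0%R, +oo[%classic = [set: R] :> set R.
  apply/seteqP; split => // z _ /=; rewrite !in_itv/= andbT.
  by case: (ltP z 0%R); [left|right].
rewrite Rintegral_setU//; last 2 first.
- by apply: integrableS ig => //; exact: measurableU.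
- rewrite disj_set2E; apply/eqP; rewrite -subset0 => x/=.
  by rewrite !in_itv/= andbT ltNge => -[/negP].
rewrite addrC; congr (_ + _).
rewrite -(@Rintegral_itv_obnd_cbnd _ 0 +oo%O (fun z => g (- z))); last first.
  by apply: integrableS igN => //; exact: measurable_itv.
rewrite Rintegral_mkcond [RHS]Rintegral_mkcond /Rintegral.
rewrite (@integral_affine 0 (-1)) ?oppr_eq0 ?oner_eq0//.
- rewrite normrN normr1 mul1e; congr fine.
  apply: eq_integral => z _; rewrite !patchE add0r mulN1r.
  by rewrite memN.
- by apply/(measurable_restrictT g) => //; exact: measurable_funTS mg.
- have : leb.-integrable [set: R] (((EFin \o (fun z => g (- z))) \_ `]0, +oo[)).
    apply/integrable_restrict; rewrite ?setTI//.
    by apply: integrableS igN => //; exact: mp'.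
  apply: eq_integrable => // z _; rewrite /= !patchE add0r mulN1r.
  by rewrite memN; case: ifP.
Qed.

End lebesgue_tools.

(** * Termwise integration of the binomial series *)

Section binomial_integral.
Context d (T : measurableType d) (R : realType) (mu : {measure set T -> \bar R}).
Variables (D : set T) (mD : measurable D).
Implicit Types h u : T -> R.

Lemma integrable_mul_bounded h (w : T -> R) : mu.-integrable D (EFin \o h) ->
  measurable_fun D w -> (forall z, D z -> `|w z| <= 1) ->
  mu.-integrable D (EFin \o (fun z => h z * w z)).
Proof.
move=> ih mw w1.
have mh : measurable_fun D h by exact/measurable_EFinP/(measurable_int mu).
apply: le_integrable ih => //.
  by apply/measurable_EFinP; exact: measurable_funM.
by move=> z Dz; rewrite /= lee_fin normrM ler_piMr// w1.
Qed.

Lemma Rintegral_lincomb (N : nat) (c : nat -> R) (f : nat -> T -> R) :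
  (forall k, mu.-integrable D (EFin \o f k)) ->
  mu.-integrable D (EFin \o (fun z => \sum_(0 <= k < N) c k * f k z)) /\
  \int[mu]_(z in D) (\sum_(0 <= k < N) c k * f k z) =
  \sum_(0 <= k < N) c k * \int[mu]_(z in D) f k z.
Proof.
move=> fi; elim: N => [|N [i1 i2]].
  split.
    by apply: eq_integrable (integrable0 mu D) => // z _; rewrite /= big_nil.
  rewrite big_nil; under eq_Rintegral do rewrite big_nil.
  by rewrite Rintegral_cst// mul0r.
have iN : mu.-integrable D (EFin \o (fun z => c N * f N z)).
  exact: eq_integrable (integrableZl mD (c N) (fi N)).
split.
  apply: eq_integrable (integrableD mD i1 iN) => // z _.
  by rewrite /= big_nat_recr.
under eq_Rintegral do rewrite big_nat_recr//=.
by rewrite RintegralD// i2 RintegralZl// big_nat_recr.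
Qed.

Lemma integrable_abinom_sum b h u N : mu.-integrable D (EFin \o h) ->
  measurable_fun D u -> (forall z, D z -> 0 <= u z < 1) ->
  mu.-integrable D (EFin \o (fun z => h z * abinom_sum b N (u z))) /\
  \int[mu]_(z in D) (h z * abinom_sum b N (u z)) =
  \sum_(0 <= j < N) abinom b j * \int[mu]_(z in D) (h z * u z ^+ j).
Proof.
move=> ih mu' u01.
have iX j : mu.-integrable D (EFin \o (fun z => h z * u z ^+ j)).
  apply: integrable_mul_bounded => //; first exact: measurable_funX.
  move=> z Dz; have /andP[u0 u1] := u01 z Dz.
  by rewrite ger0_norm ?exprn_ge0// exprn_ile1// ltW.
have -> : (fun z => h z * abinom_sum b N (u z)) =
    (fun z => \sum_(0 <= j < N) abinom b j * (h z * u z ^+ j)).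
  apply/funext => z; rewrite /abinom_sum mulr_sumr.
  by apply: eq_bigr => j _; rewrite mulrCA.
exact: (Rintegral_lincomb N (abinom b) iX).
Qed.

(** Dominated convergence, the dominating function [C |h| + |h (1 - u) `^ b|]
    being that of [abinom_sum_bound]. Every series of the theorem is an instance,
    for some choice of [h], [u] and [b]. *)
Lemma cvg_abinom_integral b h u :
  measurable_fun D u -> (forall z, D z -> 0 <= u z < 1) ->
  mu.-integrable D (EFin \o h) ->
  mu.-integrable D (EFin \o (fun z => h z * (1 - u z) `^ b)) ->
  (fun N => \sum_(0 <= j < N) abinom b j *
     \int[mu]_(z in D) (h z * u z ^+ j)) @ \oo -->
  \int[mu]_(z in D) (h z * (1 - u z) `^ b).
Proof.
move=> mu' u01 ih ihb.
have [C C0 bnd] := abinom_sum_bound b.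
pose g z := C * `|h z| + `|h z * (1 - u z) `^ b|.
have ig : mu.-integrable D (EFin \o g).
  have H1 := integrableZl mD C (integrable_norm ih).
  apply: eq_integrable (integrableD mD H1 (integrable_norm ihb)) => //.
have iS N := integrable_abinom_sum b N ih mu' u01.
have cv z : D z -> (fun N => (h z * abinom_sum b N (u z))%:E) @ \oo -->
    (h z * (1 - u z) `^ b)%:E.
  move=> Dz; apply/cvg_EFin; first by near=> N.
  by apply: cvgMl_tmp; exact/cvg_abinom_sum/u01.
have dom z N : D z -> (`|(h z * abinom_sum b N (u z))%:E| <= (EFin \o g) z)%E.
  move=> Dz; rewrite /= lee_fin normrM /g [X in _ + X]normrM.
  rewrite (mulrC C) -mulrDr ler_wpM2l// (ger0_norm (powR_ge0 _ _)).
  by rewrite bnd// u01.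
have [_ _] := @dominated_convergence _ _ _ mu D mD
  (fun N z => (h z * abinom_sum b N (u z))%:E)
  (fun z => (h z * (1 - u z) `^ b)%:E) (EFin \o g)
  (fun N => measurable_int mu (iS N).1) (measurable_int mu ihb)
  (aeW _ cv) ig (aeW _ dom).
move=> H.
suff -> : (fun N => \sum_(0 <= j < N) abinom b j *
     \int[mu]_(z in D) (h z * u z ^+ j)) =
  (fun N => fine (\int[mu]_(z in D) (h z * abinom_sum b N (u z))%:E)%E).
  apply: fine_cvg; rewrite fineK//; exact: integrable_fin_num.
by apply/funext => N; rewrite -(iS N).2.
Unshelve. all: by end_near. Qed.
End binomial_integral.

(** * Integrability of the gamma integrand *)

Section integrability.
Context {R : realType}.
Local Notation leb := (@lebesgue_measure R).
Implicit Types (p x y z t : R).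

Lemma integrable_oneDsqrV : leb.-integrable [set: R] (fun z => (oneDsqr z)^-1%:E).
Proof.
have c : continuous (fun z : R => (oneDsqr z)^-1) by exact: continuous_oneDsqrV.
apply/integrableP; split.
  by apply/measurable_EFinP; exact: continuous_measurable_fun.
under eq_integral => z _.
  rewrite gee0_abs ?lee_fin ?invr_ge0 ?(le_trans ler01 (oneDsqr_ge1 z))//.
  over.
have f0 z : 0 <= (oneDsqr z)^-1 :> R.
  by rewrite invr_ge0 (le_trans ler01 (oneDsqr_ge1 z)).
have fN : (fun z : R => (oneDsqr z)^-1) =1 (fun z : R => (oneDsqr z)^-1) \o -%R.
  by move=> z; rewrite /= /oneDsqr sqrrN.
by rewrite (ge0_symfun_integralT f0 c fN) -set_itvcy integral0y_oneDsqr -EFinM ltry.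
Qed.

(** From [1 + eta y <= exp (eta y)], raised to the power [k], for [eta] small
    enough that [k * eta <= dl]. *)
Lemma poly_le_expR (k : nat) (dl : R) : 0 < dl ->
  exists2 C : R, 0 < C & forall y, 0 <= y -> (1 + y) ^+ k <= C * expR (dl * y).
Proof.
move=> d0.
pose eta := Num.min 1 (dl / k.+1%:R).
have k0 : 0 < k.+1%:R :> R by rewrite ltr0n.
have eta0 : 0 < eta by rewrite lt_min ltr01 divr_gt0.
have eta1 : eta <= 1 by rewrite ge_min lexx.
have etad : k%:R * eta <= dl.
  rewrite (@le_trans _ _ (k.+1%:R * eta))//.
    by rewrite ler_wpM2r ?(ltW eta0)// ler_nat.
  by rewrite -ler_pdivlMl// mulrC ge_min lexx orbT.
exists (eta^-1 ^+ k); first by rewrite exprn_gt0// invr_gt0.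
move=> y y0.
have h1 : 1 + y <= eta^-1 * expR (eta * y).
  rewrite ler_pdivlMl//; have := expR_ge1Dx (eta * y).
  by nra.
apply: (@le_trans _ _ ((eta^-1 * expR (eta * y)) ^+ k)).
  by apply: lerXn2r => //; rewrite nnegrE ?mulr_ge0 ?invr_ge0 ?expR_ge0 ?(ltW eta0)//; lra.
rewrite exprMn ler_wpM2l ?exprn_ge0 ?invr_ge0 ?(ltW eta0)//.
by rewrite -expRM_natl ler_expR mulrA ler_wpM2r.
Qed.

(** The primitive [t `^ p / p] bounds the integrals over [1 / (n + 2), 1] by
    [1 / p], and these intervals exhaust the domain. *)
Lemma integrable_powR0 p : 0 < p ->
  leb.-integrable `]0, 1] (EFin \o (fun t : R => t `^ (p - 1))).
Proof.
move=> p0.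
have mf (D : set R) : measurable_fun D (EFin \o (fun t : R => t `^ (p - 1))).
  by apply/measurable_EFinP; apply: measurable_funTS; exact: measurable_powR.
apply/integrableP; split; first exact: mf.
under eq_integral => z _ do rewrite gee0_abs ?lee_fin ?powR_ge0//.
pose F (n : nat) : set R := `[n.+2%:R^-1, 1]%classic.
have FE : \bigcup_n F n = `]0, 1]%classic.
  apply/seteqP; split => t.
    move=> [n _]; rewrite /F /= !in_itv/= => /andP[h1 ->]; rewrite andbT.
    by rewrite (lt_le_trans _ h1)// invr_gt0.
  rewrite /= in_itv/= => /andP[t0 t1].
  exists (Num.truncn t^-1) => //; rewrite /F /= in_itv/= t1 andbT.
  rewrite -[leRHS]invrK lef_pV2 ?posrE ?invr_gt0//.
  by rewrite ltW// (lt_le_trans (truncnS_gt _))// ler_nat.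
have ndF : nondecreasing_seq F.
  move=> m n mn; rewrite subsetEset => t; rewrite /F /= !in_itv/= => /andP[h1 ->].
  by rewrite andbT (le_trans _ h1)// lef_pV2 ?posrE// ler_nat !ltnS.
have mF i : measurable (F i) by exact: measurable_itv.
have H := @ge0_nondecreasing_set_cvg_integral _ (measurableTypeR R) R F
  (EFin \o (fun t : R => t `^ (p - 1))) leb ndF mF (fun i => mf (F i))
  (fun i t _ => powR_ge0 t (p - 1)).
rewrite FE in H.
apply: (@le_lt_trans _ _ (p^-1%:E)); last exact: ltry.
rewrite -(cvg_lim _ H)//; apply: lime_le; first exact: cvgP H.
apply: nearW => n.
pose G (t : R) : R := p^-1 * t `^ p.
have a0 : 0 < n.+2%:R^-1 :> R by rewrite invr_gt0.
have a1 : n.+2%:R^-1 < 1 :> R by rewrite invf_lt1// ltr1n.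
have dG t : 0 < t -> is_derive t 1 G (t `^ (p - 1)).
  move=> t0; have h := is_derive1_powR p t0.
  have -> : G = p^-1 \*: (fun t : R => t `^ p) by [].
  by apply: is_derive_eq; rewrite /GRing.scale/= mulrA mulVf ?mul1r// gt_eqF.
have cG t : 0 < t -> {for t, continuous G}.
  move=> t0; apply: differentiable_continuous; apply/derivable1_diffP.
  by have [] := dG t t0.
rewrite (@continuous_FTC2 _ _ G)//.
- rewrite -EFinB lee_fin /G powR1 mulr1 lerBlDr lerDl mulr_ge0 ?powR_ge0//.
  by rewrite invr_ge0 ltW.
- apply: derivable_within_continuous => t; rewrite in_itv/= => /andP[h1 _].
  by apply: derivable_powR; rewrite in_itv/= andbT (lt_le_trans a0).
- split.
  + move=> t; rewrite in_itv/= => /andP[h1 _].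
    by have [] := dG t (lt_trans a0 h1).
  + exact/cvg_at_right_filter/cG.
  + exact/cvg_at_left_filter/cG.
- move=> t; rewrite in_itv/= => /andP[h1 _]; rewrite derive1E.
  by have [_ ->] := dG t (lt_trans a0 h1).
Qed.

(** Near 0 the integrand is at most [t `^ (p - 1)]; elsewhere it is at most a
    multiple of [1 / (1 + t ^ 2)]. *)
Lemma integrable_gamma p : 0 < p ->
  leb.-integrable `[0, +oo[ (EFin \o (fun t => t `^ (p - 1) * expR (- t))).
Proof.
move=> p0.
pose k := (Num.truncn p).+1.
have [C C0 HC] := @poly_le_expR (k + 2) 1 ltr01.
pose g (t : R) : \bar R := (((EFin \o (fun t : R => t `^ (p - 1))%R) \_ `]0%R, 1%R]) t
  + C%:E * (oneDsqr t)^-1%:E)%E.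
have ig : leb.-integrable [set: R] g.
  apply: integrableD => //.
    have mI : measurable (`]0, 1]%classic : set (measurableTypeR R)).
      exact: measurable_itv.
    exact: (proj1 (integrable_mkcond _ mI) (integrable_powR0 p0)).
  by apply: integrableZl => //; exact: integrable_oneDsqrV.
have mf : measurable_fun [set: R] (fun t => t `^ (p - 1) * expR (- t)).
  apply: measurable_funM; first exact: measurable_powR.
  by apply: measurableT_comp => //; exact: measurable_expR.
have ig' : leb.-integrable `[0, +oo[ g.
  by apply: integrableS ig => //; exact: measurable_itv.
apply: le_integrable ig' => //.
- by apply/measurable_EFinP; exact: measurable_funTS.
- move=> t t0'; have t0 : 0 <= t by move: t0'; rewrite /= in_itv/= andbT.
  have hC : (1 + t) ^+ k * (1 + t ^+ 2) * expR (- t) <= C.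
    rewrite expRN ler_pdivrMr ?expR_gt0//.
    have := HC t t0; rewrite mul1r; apply: le_trans.
    by rewrite exprD ler_wpM2l ?exprn_ge0//; [lra|nra].
  have D0 : 0 < oneDsqr t by rewrite (lt_le_trans ltr01 (oneDsqr_ge1 t)).
  have hq : 1 <= (1 + t) ^+ k by rewrite exprn_ege1// lerDl.
  have e0 := ltW (expR_gt0 (- t)).
  have D0' := ltW D0.
  have CD0 : 0 <= C / oneDsqr t by rewrite divr_ge0// ltW.
  have C1 : expR (- t) <= C / oneDsqr t.
    rewrite ler_pdivlMr// (le_trans _ hC)// mulrC ler_wpM2r//.
    by rewrite -/(oneDsqr t) ler_peMl.
  rewrite gee0_abs; last by rewrite /= lee_fin mulr_ge0 ?powR_ge0.
  rewrite /g patchE [X in (X <= _)%E]/=; case: ifPn.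
    rewrite inE/= in_itv/= => /andP[t_gt0 t1].
    rewrite /= lee_fin ger0_norm ?addr_ge0 ?powR_ge0//.
    rewrite (@le_trans _ _ (t `^ (p - 1)))//; last by rewrite lerDl.
    by rewrite ler_piMr ?powR_ge0// -expR0 ler_expR oppr_le0.
  rewrite notin_setE/= in_itv/= => /negP.
  rewrite negb_and -leNgt -ltNge => tt.
  rewrite add0r lee_fin ger0_norm//.
  have [tz|tN] := eqVneq t 0.
    move: C1; rewrite tz oppr0 expR0 mulr1; apply: le_trans.
    by have [->|pN] := eqVneq (p - 1) 0; [rewrite powRr0|rewrite powR0].
  have t1 : 1 < t by case/orP : tt => // tle; move: tN; rewrite eq_le tle t0.
  rewrite ler_pdivlMr// (le_trans _ hC)// mulrAC ler_wpM2r//.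
  rewrite ler_wpM2r//.
  apply: (@le_trans _ _ (t ^+ k)).
    rewrite -powR_mulrn// ler_powR ?(ltW t1)//.
    by rewrite (@le_trans _ _ p)// ?gerBl// ltW// truncnS_gt.
  by apply: lerXn2r; rewrite ?nnegrE//; lra.
Qed.
End integrability.

(** * The generalized normal distribution function *)

Section generalized_normal.
Context {R : realType}.
Local Notation leb := (@lebesgue_measure R).
Implicit Types (a b p s x y z t : R).

Lemma integrable_upper_gamma p x : 0 < p -> 0 <= x ->
  leb.-integrable `[x, +oo[ (EFin \o (fun t => t `^ (p - 1) * expR (- t))).
Proof.
move=> p0 x0; apply: integrableS (integrable_gamma p0) => //.
by move=> t /=; rewrite !in_itv/= !andbT; exact: le_trans x0.
Qed.

Lemma gamma_integrand_ge0 p t : 0 <= t `^ (p - 1) * expR (- t).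
Proof. by rewrite mulr_ge0 ?powR_ge0 ?expR_ge0. Qed.

Lemma upper_gamma_ge0 p x : 0 <= upper_gamma p x.
Proof. by apply: Rintegral_ge0 => t _; exact: gamma_integrand_ge0. Qed.

Lemma upper_gamma_fineE p x : 0 < p -> 0 <= x ->
  ((upper_gamma p x)%:E = \int[leb]_(t in `[x, +oo[) (t `^ (p - 1) * expR (- t))%R%:E)%E.
Proof.
move=> p0 x0; rewrite /upper_gamma /Rintegral fineK//.
by apply: integrable_fin_num; [exact: measurable_itv|exact: integrable_upper_gamma].
Qed.

Lemma measurable_gamma_integrand p (A : set R) :
  measurable_fun A (fun t => (t `^ (p - 1) * expR (- t))%R%:E).
Proof.
apply/measurable_EFinP; apply: measurable_funTS.
apply: measurable_funM; first exact: measurable_powR.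
by apply: measurableT_comp => //; exact: measurable_expR.
Qed.

Lemma upper_gamma_nonincr p x y : 0 < p -> 0 <= x -> x <= y ->
  upper_gamma p y <= upper_gamma p x.
Proof.
move=> p0 x0 xy; rewrite -lee_fin !upper_gamma_fineE ?(le_trans x0)//.
apply: ge0_subset_integral => //.
- exact: measurable_gamma_integrand.
- by move=> t _; rewrite lee_fin gamma_integrand_ge0.
- by move=> t /=; rewrite !in_itv/= !andbT; exact: le_trans xy.
Qed.

(** Crude but explicit: restrict the integral to [x + 1, x + 2], where
    [t `^ (p - 1) >= 1 / t] because [t >= 1] and [p > 0]. Up to a polynomial
    factor this is the true order of the tail. *)
Lemma upper_gamma_ge p x : 0 < p -> 0 <= x ->
  expR (- (x + 2)) / (x + 2) <= upper_gamma p x.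
Proof.
move=> p0 x0; rewrite -lee_fin upper_gamma_fineE//.
have x20 : 0 < x + 2 by lra.
apply: (@le_trans _ _ (\int[leb]_(t in `[(x + 1)%R, (x + 2)%R]) (t `^ (p - 1) * expR (- t))%R%:E)%E); last first.
  apply: ge0_subset_integral => //.
  - exact: measurable_gamma_integrand.
  - by move=> t _; rewrite lee_fin gamma_integrand_ge0.
  - by move=> t /=; rewrite !in_itv/= !andbT => /andP[t1 _]; lra.
apply: (@le_trans _ _ (\int[leb]_(t in `[(x + 1)%R, (x + 2)%R]) (expR (- (x + 2)) / (x + 2))%:E)%E).
  rewrite integral_cst//= lebesgue_measure_itv/= lte_fin.
  rewrite ifT; last lra.
  by rewrite -EFinB -EFinM lee_fin (_ : x + 2 - (x + 1) = 1) ?mulr1//; ring.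
apply: ge0_le_integral => //.
- by move=> t _; rewrite lee_fin divr_ge0 ?expR_ge0 ?ltW.
- exact: measurable_gamma_integrand.
- move=> t /=; rewrite in_itv/= => /andP[t1 t2]; rewrite lee_fin mulrC.
  have t0 : 1 <= t by lra.
  apply: ler_pM; [by rewrite invr_ge0 ltW|exact: expR_ge0| |by rewrite ler_expR; lra].
  apply: (@le_trans _ _ (t `^ (- 1))); last by rewrite ler_powR//; lra.
  rewrite powR_inv1; last lra.
  by rewrite lef_pV2 ?posrE//; lra.
Qed.

Lemma gamma_gt0 p : 0 < p -> 0 < gamma p.
Proof.
move=> p0; apply: lt_le_trans (upper_gamma_ge p0 (lexx 0)).
by rewrite divr_gt0 ?expR_gt0//; lra.
Qed.

(** Mass of the tail beyond [|z|] on one side, which is the smaller of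
    [gn_cdf s z] and [1 - gn_cdf s z]. *)
Definition gn_tail s z : R := upper_gamma s^-1 (`|z| `^ s) / (2 * gamma s^-1).

Variables (s : R) (s0 : 0 < s).
Let si0 : 0 < s^-1. Proof. by rewrite invr_gt0. Qed.
Let g0 : 0 < 2 * gamma s^-1. Proof. by rewrite mulr_gt0// gamma_gt0. Qed.

Lemma gn_cdfE z : gn_cdf s z = if z <= 0 then gn_tail s z else 1 - gn_tail s z.
Proof.
rewrite /gn_cdf /gn_tail; case: (lerP z 0) => z0; first by rewrite ler0_norm.
by rewrite gtr0_norm.
Qed.

Lemma gn_tail_gt0 z : 0 < gn_tail s z.
Proof.
rewrite /gn_tail; move: (`|z| `^ s) (powR_ge0 `|z| s) => y y0.
have y20 : 0 < y + 2 by lra.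
apply: divr_gt0; last exact: g0.
by apply: lt_le_trans (upper_gamma_ge si0 y0); rewrite divr_gt0 ?expR_gt0.
Qed.

Lemma gn_tail_nonincr x y : `|x| <= `|y| -> gn_tail s y <= gn_tail s x.
Proof.
move=> xy; rewrite /gn_tail; apply: ler_wpM2r.
  by rewrite invr_ge0 ltW.
apply: upper_gamma_nonincr; [exact: si0|exact: powR_ge0|].
by apply: ge0_ler_powR; rewrite ?nnegrE// ltW.
Qed.

Lemma gn_tail0 : gn_tail s 0 = 2^-1.
Proof.
rewrite /gn_tail normr0 powR0 ?gt_eqF// -/(gamma _).
by rewrite invfM mulrCA mulfV ?mulr1// gt_eqF// gamma_gt0.
Qed.

Lemma gn_tail_le z : gn_tail s z <= 2^-1.
Proof. by rewrite -gn_tail0 gn_tail_nonincr// normr0. Qed.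

Lemma gn_cdf01 z : 0 < gn_cdf s z < 1.
Proof.
rewrite gn_cdfE; have := gn_tail_gt0 z; have := gn_tail_le z.
by move: (gn_tail s z) => t; case: ifP => _; lra.
Qed.

Lemma gn_cdfN z : gn_cdf s (- z) = 1 - gn_cdf s z.
Proof.
have tN : gn_tail s (- z) = gn_tail s z by rewrite /gn_tail normrN.
rewrite !gn_cdfE tN oppr_le0.
case: (ltgtP z 0) => [z0|z0|->] /=.
- by [].
- by move: (gn_tail s z) {tN} => t; lra.
- by rewrite gn_tail0 {tN}; lra.
Qed.

Lemma gn_cdf_nondecr : nondecreasing_fun (gn_cdf s).
Proof.
move=> x y xy; rewrite !gn_cdfE.
case: (lerP x 0) => x0; case: (lerP y 0) => y0.
- by apply: gn_tail_nonincr; rewrite !ler0_norm// lerN2.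
- have := gn_tail_le x; have := gn_tail_le y.
  by move: (gn_tail s x) (gn_tail s y) => tx ty; lra.
- by move: x0; rewrite ltNge (le_trans xy y0).
- by rewrite lerD2l lerN2; apply: gn_tail_nonincr; rewrite !gtr0_norm.
Qed.

Lemma measurable_gn_cdf : measurable_fun [set: R] (gn_cdf s).
Proof. exact: nondecreasing_measurable measurableT gn_cdf_nondecr. Qed.

Lemma measurable_gn_pdf : measurable_fun [set: R] (gn_pdf s).
Proof.
apply: measurable_funM => //.
apply: measurableT_comp => //; apply: measurableT_comp => //.
by apply: (measurableT_comp (measurable_powR s)) => //; exact: measurable_normr.
Qed.

Lemma gn_pdfN z : gn_pdf s (- z) = gn_pdf s z.
Proof. by rewrite /gn_pdf normrN. Qed.

Lemma gn_pdf_ge0 z : 0 <= gn_pdf s z.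
Proof. by rewrite mulr_ge0 ?expR_ge0// divr_ge0// ltW. Qed.

End generalized_normal.

(** * Integrability of the weighted moments *)

Section weighted_moments.
Context {R : realType}.
Local Notation leb := (@lebesgue_measure R).
Implicit Types (a b z : R).
Variables (s : R) (s0 : 0 < s).

(** Powers of [|z|] are traded for natural powers of [y = |z| `^ s]: for
    [|z| >= 1] it is enough that [s * m >= i + 2], and for [|z| <= 1] the
    left-hand side is at most 2. *)
Lemma abs_pow_le (i : nat) : exists m : nat, forall z,
  `|z| ^+ i * oneDsqr z <= 2 * (1 + `|z| `^ s) ^+ m.
Proof.
pose m := (Num.truncn ((i + 2)%:R / s)).+1.
have smi : (i + 2)%:R <= s * m%:R.
  by rewrite mulrC -ler_pdivrMr// ltW// /m truncnS_gt.
exists m => z; set x := `|z|; have x0 : 0 <= x := normr_ge0 z.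
have y0 : 0 <= x `^ s := powR_ge0 _ _.
have -> : oneDsqr z = 1 + x ^+ 2 by rewrite /oneDsqr /x real_normK ?num_real.
have q1 : 1 <= (1 + x `^ s) ^+ m by rewrite exprn_ege1// lerDl.
have [x1|x1] := leP x 1.
  have h1 : x ^+ i <= 1 by rewrite exprn_ile1.
  have h2 : x ^+ 2 <= 1 by rewrite exprn_ile1.
  have h3 : 0 <= x ^+ i by rewrite exprn_ge0.
  have h4 : 0 <= x ^+ 2 by rewrite exprn_ge0.
  nra.
have h1 : x ^+ (i + 2) <= (1 + x `^ s) ^+ m.
  apply: (@le_trans _ _ ((x `^ s) ^+ m)); last first.
    by apply: lerXn2r; rewrite ?nnegrE//; lra.
  rewrite -!powR_mulrn// -powRrM ler_powR// ltW//.
have h2 : 1 <= x ^+ 2 by rewrite exprn_ege1// ltW.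
have h3 : 0 <= x ^+ i by rewrite exprn_ge0.
rewrite (@le_trans _ _ (2 * x ^+ (i + 2)))//; last lra.
by rewrite exprD; nra.
Qed.

(** Both [u] and [1 - u] lie in (0, 1), so lowering an exponent only increases
    the power. *)
Lemma powR_pair_le (th u a b : R) : 0 < u < 1 -> - th <= a -> - th <= b ->
  u `^ a * (1 - u) `^ b <= (u * (1 - u)) `^ (- th).
Proof.
move=> /andP[u0 u1] ha hb.
have v0 : 0 < 1 - u by lra.
rewrite powRM ?(ltW u0) ?(ltW v0)//; apply: ler_pM; rewrite ?powR_ge0//.
  by apply: ger_powR => //; rewrite u0 ltW.
by apply: ger_powR => //; rewrite v0; lra.
Qed.

(** Raising the lower bound on the tail to the power [- th] costs a factor
    [exp (th y)] with [th < 1], which [exp (- y)] will absorb. *)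
Lemma tail_powR_le (th c y x : R) : 0 <= th -> th < 1 -> 0 < c -> 0 <= y ->
  c * expR (- y) / (y + 2) <= x ->
  x `^ (- th) <= (1 + 2 / c) * (1 + y) * expR (th * y).
Proof.
move=> th0 th1 c0 y0 Lx.
have y20 : 0 < y + 2 by lra.
have E0 := expR_gt0 (- y).
have L0 : 0 < c * expR (- y) / (y + 2) by rewrite divr_gt0 ?mulr_gt0.
have x0 : 0 < x by exact: lt_le_trans Lx.
have Q0 : 0 < (y + 2) / c by rewrite divr_gt0.
apply: (@le_trans _ _ (((y + 2) / c * expR y) `^ th)).
  have -> : x `^ (- th) = x^-1 `^ th.
    by rewrite -[x^-1]powR_inv1 ?(ltW x0)// -powRrM mulN1r.
  apply: ge0_ler_powR => //; rewrite ?nnegrE ?invr_ge0 ?(ltW x0)//.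
    by rewrite mulr_ge0 ?expR_ge0 ?ltW.
  have -> : (y + 2) / c * expR y = (c * expR (- y) / (y + 2))^-1.
    by rewrite expRN !invfM !invrK; ring.
  by rewrite lef_pV2 ?posrE.
rewrite powRM ?expR_ge0 ?(ltW Q0)// -expRM mulrC.
rewrite [leRHS]mulrC (mulrC y) ler_wpM2l ?expR_ge0//.
apply: (@le_trans _ _ (1 + (y + 2) / c)).
  have [q1|q1] := leP ((y + 2) / c) 1.
    apply: (@le_trans _ _ 1); last by rewrite lerDl ltW.
    apply: (@le_trans _ _ (1 `^ th)); last by rewrite powR1.
    by apply: ge0_ler_powR; rewrite ?nnegrE// ltW.
  apply: (@le_trans _ _ ((y + 2) / c)); last by rewrite lerDr.
  by apply: ler1_powR; exact: ltW.
have ci0 : 0 < c^-1 by rewrite invr_gt0.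
by nra.
Qed.

(** One factor is the tail, bounded below by [upper_gamma_ge], and the other one
    is at least 1/2. *)
Lemma gn_cdf_prod_ge : exists2 c : R, 0 < c & forall z,
  c * expR (- (`|z| `^ s)) / (`|z| `^ s + 2) <= gn_cdf s z * (1 - gn_cdf s z).
Proof.
have si0 : 0 < s^-1 by rewrite invr_gt0.
have g0 : 0 < 2 * gamma s^-1 by rewrite mulr_gt0// gamma_gt0.
exists (expR (- 2) / (2 * (2 * gamma s^-1))).
  by rewrite divr_gt0 ?expR_gt0// mulr_gt0.
move=> z; have y0 := powR_ge0 `|z| s; set y := `|z| `^ s in y0 *.
have tl : expR (- (y + 2)) / (y + 2) / (2 * gamma s^-1) <= gn_tail s z.
  by rewrite /gn_tail ler_wpM2r ?upper_gamma_ge// invr_ge0 ltW.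
have -> : expR (- 2) / (2 * (2 * gamma s^-1)) * expR (- y) / (y + 2) =
   2^-1 * (expR (- (y + 2)) / (y + 2) / (2 * gamma s^-1)).
  have alg (e2 ey G x : R) : G != 0 -> x != 0 ->
      e2 / (2 * G) * ey / x = 2^-1 * (ey * e2 / x / G).
    by move=> G0 x0; field; rewrite G0 x0.
  rewrite (_ : - (y + 2) = - y + - 2); last by rewrite opprD.
  by rewrite expRD; apply: alg; rewrite gt_eqF//; lra.
have t0 := gn_tail_gt0 s0 z; have t1 := gn_tail_le s0 z.
apply: (@le_trans _ _ (2^-1 * gn_tail s z)); first by rewrite ler_pM2l.
rewrite gn_cdfE//; case: ifP => _; nra.
Qed.

(** With [y = |z| `^ s] the density decays like [exp (- y)] and the negative
    powers of the distribution function grow at most like [(1 + y) exp (th y)]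
    for some [th < 1]; what is left, [exp (- (1 - th) y)], beats the remaining
    polynomial factors. The assumptions [-1 < a] and [-1 < b] are exactly what
    makes [th < 1] possible. *)
Lemma gn_weight_bound (i : nat) a b : -1 < a -> -1 < b ->
  exists2 K : R, 0 <= K & forall z,
    `|z ^+ i * gn_pdf s z * (gn_cdf s z `^ a * (1 - gn_cdf s z) `^ b)| <=
    K / oneDsqr z.
Proof.
move=> a1 b1.
(* the largest exponent with which a factor can appear in a denominator *)
pose th := Num.max 0 (Num.max (- a) (- b)).
have th0 : 0 <= th by rewrite le_max lexx.
have th1 : th < 1 by rewrite !gt_max ltr01 /=; apply/andP; split; lra.
have tha : - th <= a by rewrite lerNl !le_max lexx !orbT.
have thb : - th <= b by rewrite lerNl !le_max lexx !orbT.
have [m hm] := abs_pow_le i.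
have [c c0 hc] := gn_cdf_prod_ge.
have d0 : 0 < 1 - th by lra.
have [C C0 hC] := poly_le_expR m.+1 d0.
pose q := s / (2 * gamma s^-1).
have si0 : 0 < s^-1 by rewrite invr_gt0.
have q0 : 0 < q by rewrite divr_gt0// mulr_gt0// gamma_gt0.
have K0 : 0 <= 2 * q * (1 + 2 / c).
  by apply: mulr_ge0; [rewrite mulr_ge0// ltW|rewrite addr_ge0// divr_ge0// ltW].
exists (2 * q * (1 + 2 / c) * C); first exact: mulr_ge0 K0 (ltW C0).
move=> z.
have D0 : 0 < oneDsqr z by rewrite (lt_le_trans ltr01 (oneDsqr_ge1 z)).
rewrite ler_pdivlMr//.
have /andP[u0 u1] := gn_cdf01 s0 z.
set W := _ `^ a * _.
have W0 : 0 <= W by rewrite mulr_ge0 ?powR_ge0.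
rewrite normrM normrM normrX (ger0_norm (gn_pdf_ge0 s0 z)) (ger0_norm W0).
have := hm z; have := hc z; have y0 := powR_ge0 `|z| s.
rewrite /gn_pdf -/q; set y := `|z| `^ s in y0 * => hcz hmz.
have E0 := expR_gt0 (- y); have Et0 := expR_gt0 (th * y).
have Wle : W <= (1 + 2 / c) * (1 + y) * expR (th * y).
  apply: (le_trans (powR_pair_le _ tha thb)); first by rewrite u0.
  exact: (tail_powR_le th0 th1 c0 y0 hcz).
have H1 : (1 + y) ^+ m * expR (- y) * ((1 + y) * expR (th * y)) <= C.
  have -> : (1 + y) ^+ m * expR (- y) * ((1 + y) * expR (th * y)) =
    (1 + y) ^+ m.+1 * expR (- ((1 - th) * y)).
    rewrite (_ : - ((1 - th) * y) = - y + th * y); last ring.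
    by rewrite expRD exprS; ring.
  by rewrite expRN ler_pdivrMr ?expR_gt0// hC.
have xi0 : 0 <= `|z| ^+ i by rewrite exprn_ge0.
have step : `|z| ^+ i * (q * expR (- y)) * W * oneDsqr z <=
    2 * (1 + y) ^+ m * (q * expR (- y)) * ((1 + 2 / c) * (1 + y) * expR (th * y)).
  rewrite (_ : _ * oneDsqr z = `|z| ^+ i * oneDsqr z * (q * expR (- y)) * W); last ring.
  apply: ler_pM => //.
    exact: (mulr_ge0 (mulr_ge0 xi0 (ltW D0)) (mulr_ge0 (ltW q0) (ltW E0))).
  by apply: ler_wpM2r => //; exact: (mulr_ge0 (ltW q0) (ltW E0)).
apply: (le_trans step).
rewrite [leLHS](_ : _ = 2 * q * (1 + 2 / c) *
  ((1 + y) ^+ m * expR (- y) * ((1 + y) * expR (th * y)))); last ring.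
exact: ler_wpM2l.
Qed.

Lemma integrable_gn_weight (i : nat) a b : -1 < a -> -1 < b ->
  leb.-integrable [set: R] (EFin \o
    (fun z => z ^+ i * gn_pdf s z * (gn_cdf s z `^ a * (1 - gn_cdf s z) `^ b))).
Proof.
move=> a1 b1; have [K K0 HK] := gn_weight_bound i a1 b1.
have mPhi := measurable_gn_cdf s0.
have H := integrableZl measurableT K (@integrable_oneDsqrV R).
apply: le_integrable H => //.
- apply/measurable_EFinP; apply: measurable_funM.
    by apply: measurable_funM; [exact: exprn_measurable|exact: measurable_gn_pdf].
  apply: measurable_funM; first by apply: (measurableT_comp (measurable_powR a)).
  apply: (measurableT_comp (measurable_powR b)) => //.
  exact: measurable_funB.
- move=> z _; rewrite /= lee_fin (le_trans (HK z))//; exact: ler_norm.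
Qed.

End weighted_moments.

(** * The coefficients v and the two partial sums of the double series *)

Section divergence.
Context {R : realType}.
Implicit Types a : R.

Lemma gbinom_eq0 (N m : nat) : (N < m)%N -> gbinom (N%:R : R) m = 0.
Proof.
move=> Nm; rewrite /gbinom (bigD1 (Ordinal Nm))//= subrr !mul0r//.
Qed.

Lemma gbinom_neq0 a m : (forall N : nat, a != N%:R) -> gbinom a m != 0.
Proof.
move=> aN; rewrite /gbinom mulf_neq0 ?invr_eq0 ?pnatr_eq0 -?lt0n ?fact_gt0//.
by apply/prodf_neq0 => i _; rewrite subr_eq0.
Qed.

Lemma v_partS a k M : (k <= M)%N ->
  v_part a k M.+1 = v_part a k M + (-1) ^+ (k + M) * gbinom a M * 'C(M, k)%:R.
Proof. by move=> kM; rewrite /v_part big_nat_recr. Qed.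

(** Passing from [m] to [m + 1] multiplies the right-hand side by
    [|m - a| / (m + 1 - k)], which is at least 1 as soon as [k >= a + 1]. *)
Lemma v_part_term_ge a k m : a + 1 <= k%:R -> (k <= m)%N ->
  `|gbinom a k| <= `|gbinom a m| * 'C(m, k)%:R.
Proof.
move=> ak; elim: m => [|m IH].
  by rewrite leqn0 => /eqP ->; rewrite bin0 mulr1.
rewrite leq_eqVlt => /orP[/eqP <-|]; first by rewrite binn mulr1.
rewrite ltnS => km; apply: (le_trans (IH km)).
have mk0 : 0 < (m.+1 - k)%:R :> R by rewrite ltr0n subn_gt0 ltnS.
have m0 : 0 < m.+1%:R :> R by rewrite ltr0n.
have mE : (m.+1 - k)%:R = m.+1%:R - k%:R :> R by rewrite natrB// ltnW.
have mS : m.+1%:R = m%:R + 1 :> R by rewrite -natr1.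
have am : (m.+1 - k)%:R <= `|a - m%:R|.
  by rewrite distrC (le_trans _ (ler_norm _))// mE mS; lra.
rewrite -(ler_pM2r mk0).
have -> : `|gbinom a m.+1| * 'C(m.+1, k)%:R * (m.+1 - k)%:R =
    `|gbinom a m * (a - m%:R)| * 'C(m, k)%:R.
  rewrite -gbinomS [in RHS]normrM (ger0_norm (ltW m0)) -mulrA -mulrA -!natrM mulnC.
  by rewrite -(mul_bin_down m.+1 k).
by rewrite [in leRHS]normrM [leLHS]mulrAC ler_wpM2r// ler_wpM2l.
Qed.

(** If [a] is not a natural number, none of its binomial coefficients vanish,
    and for [k >= a + 1] the terms of the series stay away from 0 by
    [v_part_term_ge]. Hence convergence for all [k] forces [a] to be natural,
    and then every series involved is a finite sum. *)
Lemma cvg_v_part_natural a : (forall k, cvgn (v_part a k)) ->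
  exists N : nat, a = N%:R.
Proof.
move=> cv; apply: contrapT => aN.
have {}aN (N : nat) : a != N%:R by apply/eqP => aE; apply: aN; exists N.
pose k := (Num.truncn `|a|).+2.
have ak : a + 1 <= k%:R.
  rewrite /k -natr1 lerD2r (le_trans (ler_norm a))// ltW// truncnS_gt//.
have g0 : 0 < `|gbinom a k| by rewrite normr_gt0 gbinom_neq0.
have H : (fun M => v_part a k M.+1 - v_part a k M) @ \oo --> (0 : R).
  rewrite -(subrr (limn (v_part a k))); apply: cvgB; last exact: cv.
  by rewrite (cvg_shiftS (v_part a k)); exact: cv.
have g20 : 0 < `|gbinom a k| / 2 by rewrite divr_gt0.
move/cvgr0_norm_le : H => /(_ _ g20) [N _ HN].
have := HN (maxn N k) (leq_maxl N k).
rewrite /= v_partS ?leq_maxr// addrAC subrr add0r normrM normrMsign normr_nat.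
move=> h.
have := le_trans (v_part_term_ge ak (leq_maxr N k)) h.
lra.
Qed.

(** The terms of rank above [N] vanish. *)
Lemma v_part_stable (N k M : nat) : (N < M)%N ->
  v (N%:R : R) k = v_part (N%:R : R) k M.
Proof.
have E M' : (N < M')%N -> v_part (N%:R : R) k M' = v_part (N%:R : R) k N.+1.
  move=> NM; elim: M' NM => // M' IH; rewrite ltnS leq_eqVlt => /orP[/eqP<-//|NM].
  rewrite -IH//; have [kM|Mk] := leqP k M'.
    by rewrite v_partS// gbinom_eq0// mulr0 mul0r addr0.
  by rewrite /v_part !big_geq// ltnW.
move=> NM; rewrite E// /v; apply/cvg_lim => //; apply: cvg_near_cst.
by exists N.+1 => // n /= Nn; exact: E.
Qed.

(** By [v_part_stable] the truncated coefficients have already reached their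
    limits. *)
Lemma inner_iterated_joint s i (N M : nat) : (N < M)%N ->
  inner_iterated s i (N%:R : R) M = inner_joint s i (N%:R : R) M.
Proof.
move=> NM; rewrite /inner_iterated /inner_joint.
by apply: eq_bigr => k _; rewrite (v_part_stable k NM).
Qed.

(** Exchange of the two summations over the triangle [k <= m < M]; truncating
    both at the same rank is what makes this a finite identity. *)
Lemma sum_v_part a (j : nat -> R) M :
  \sum_(0 <= k < M) v_part a k M * j k =
  \sum_(0 <= m < M) abinom a m *
    \sum_(0 <= k < m.+1) (-1) ^+ k * 'C(m, k)%:R * j k.
Proof.
elim: M => [|M IH]; first by rewrite !big_nil.
rewrite [RHS]big_nat_recr//= -IH.
have vMM : v_part a M M = 0 by rewrite /v_part big_geq.
rewrite [LHS]big_nat_recr//= (v_partS a (leqnn M)) vMM add0r.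
under eq_big_nat => k /andP[_ kM] do rewrite v_partS ?(ltnW kM)// mulrDl.
rewrite big_split/= -addrA; congr (_ + _).
rewrite [in RHS]big_nat_recr//= mulrDr; congr (_ + _).
  rewrite mulr_sumr; apply: eq_bigr => k _.
  by rewrite /abinom exprD; ring.
by rewrite /abinom exprD; ring.
Qed.

Lemma inner_jointE s i a M : inner_joint s i a M =
  \sum_(0 <= m < M) abinom a m *
    (\sum_(0 <= k < m.+1) (-1) ^+ k * 'C(m, k)%:R * J s i k) +
  (-1) ^+ i * \sum_(0 <= k < M) abinom a k * J s i k.
Proof.
rewrite -sum_v_part mulr_sumr -big_split/=; apply: eq_bigr => k _.
by rewrite /abinom exprD; ring.
Qed.
End divergence.

(** * Weighted moments of a symmetric distribution as series *)

Section symmetric_expansion.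
Context {R : realType}.
Local Notation leb := (@lebesgue_measure R).
Implicit Types (a b z : R).
Variables (phi Phi : R -> R).

(** Probability-weighted moments of the distribution with density [phi] and
    distribution function [Phi]. *)
Definition pq_moment (i : nat) a b : R :=
  \int[leb]_z (z ^+ i * phi z * (Phi z `^ a * (1 - Phi z) `^ b)).

Hypothesis Phi01 : forall z, 0 < Phi z < 1.
Hypothesis PhiN : forall z, Phi (- z) = 1 - Phi z.
Hypothesis phiN : forall z, phi (- z) = phi z.
Hypothesis mPhi : measurable_fun [set: R] Phi.
Hypothesis integrable_pq : forall i a b, -1 < a -> -1 < b ->
  leb.-integrable [set: R] (EFin \o
    (fun z => z ^+ i * phi z * (Phi z `^ a * (1 - Phi z) `^ b))).

Let mHalf : measurable (`[0, +oo[%classic : set (measurableTypeR R)).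
Proof. exact: measurable_itv. Qed.

Lemma integrable_p i a : -1 < a -> leb.-integrable [set: R]
  (EFin \o (fun z => z ^+ i * phi z * Phi z `^ a)).
Proof.
move=> a1; have := integrable_pq i a1 (ltrN10 _).
by apply: eq_integrable => // z _; rewrite /= powRr0 mulr1.
Qed.

Lemma integrable_q i b : -1 < b -> leb.-integrable [set: R]
  (EFin \o (fun z => z ^+ i * phi z * (1 - Phi z) `^ b)).
Proof.
move=> b1; have := integrable_pq i (ltrN10 _) b1.
by apply: eq_integrable => // z _; rewrite /= powRr0 mul1r.
Qed.

Lemma integrable_p_expr i k : leb.-integrable [set: R]
  (EFin \o (fun z => z ^+ i * phi z * Phi z ^+ k)).
Proof.
have k1 : -1 < k%:R :> R by rewrite (lt_le_trans (ltrN10 _)).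
have := integrable_p i k1; apply: eq_integrable => // z _ /=.
by have /andP[p0 _] := Phi01 z; rewrite powR_mulrn ?ltW.
Qed.

Let integrable_half (f : R -> R) : leb.-integrable [set: R] (EFin \o f) ->
  leb.-integrable `[0, +oo[ (EFin \o f).
Proof. by move=> fi; exact: integrableS fi. Qed.

(** Binomial expansion of [(1 - Phi z) ^+ m] under the integral sign. *)
Lemma sum_binomial_half i m :
  \sum_(0 <= k < m.+1) (-1) ^+ k * 'C(m, k)%:R *
    \int[leb]_(z in `[0, +oo[) (z ^+ i * phi z * Phi z ^+ k) =
  \int[leb]_(z in `[0, +oo[) (z ^+ i * phi z * (1 - Phi z) ^+ m).
Proof.
have [_ <-] := Rintegral_lincomb mHalf m.+1
  (fun k => (-1) ^+ k * 'C(m, k)%:R)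
  (fun k => integrable_half (integrable_p_expr i k)).
apply: eq_Rintegral => z _; rewrite exprBn big_mkord mulr_sumr.
by apply: eq_bigr => k _; rewrite expr1n mulr1 -mulr_natr; ring.
Qed.

(** By symmetry, the substitution [z = - y] exchanges [Phi] and [1 - Phi] and
    produces the sign [(-1) ^+ i]. *)
Lemma pq_moment_half i a : -1 < a -> pq_moment i a 0 =
  \int[leb]_(z in `[0, +oo[) (z ^+ i * phi z * Phi z `^ a) +
  (-1) ^+ i * \int[leb]_(z in `[0, +oo[) (z ^+ i * phi z * (1 - Phi z) `^ a).
Proof.
move=> a1; rewrite /pq_moment Rintegral_fold; last exact: integrable_pq.
have I1 := integrable_half (integrable_p i a1).
have I2 := integrable_half (integrable_q i a1).
have I3 : leb.-integrable `[0, +oo[ (EFin \o (fun z =>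
    (-1) ^+ i * (z ^+ i * phi z * (1 - Phi z) `^ a))).
  exact: eq_integrable (integrableZl mHalf ((-1) ^+ i) I2).
rewrite -(RintegralZl ((-1) ^+ i) mHalf I2) -(RintegralD mHalf I1 I3).
apply: eq_Rintegral => z _; rewrite !powRr0 !mulr1 phiN PhiN.
by rewrite [(- z) ^+ i]exprNn; ring.
Qed.

(** On the positive half-line, [Phi `^ a] is expanded as a power series in
    [1 - Phi], each power of which is a finite combination of powers of [Phi],
    whereas [(1 - Phi) `^ a] is expanded directly in powers of [Phi]. *)
Lemma cvg_pq_moment i a : -1 < a -> (fun M =>
    \sum_(0 <= m < M) abinom a m * (\sum_(0 <= k < m.+1)
      (-1) ^+ k * 'C(m, k)%:R *
      \int[leb]_(z in `[0, +oo[) (z ^+ i * phi z * Phi z ^+ k)) +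
    (-1) ^+ i * \sum_(0 <= k < M) abinom a k *
      \int[leb]_(z in `[0, +oo[) (z ^+ i * phi z * Phi z ^+ k))
  @ \oo --> pq_moment i a 0.
Proof.
move=> a1; rewrite (pq_moment_half i a1).
have mPhiD : measurable_fun (`[0, +oo[%classic : set (measurableTypeR R)) Phi.
  exact: measurable_funTS mPhi.
have mPhiC : measurable_fun (`[0, +oo[%classic : set (measurableTypeR R))
    (fun z => 1 - Phi z).
  exact: measurable_funB.
have i0 : leb.-integrable `[0, +oo[ (EFin \o (fun z => z ^+ i * phi z)).
  apply: integrable_half; have := integrable_p_expr i 0.
  by apply: eq_integrable => // z _; rewrite /= expr0 mulr1.
have uC z : 1 - (1 - Phi z) = Phi z by rewrite opprB addrCA subrr addr0.
have L1 := @cvg_abinom_integral _ (measurableTypeR R) R leb _ mHalf a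
   (fun z => z ^+ i * phi z) (fun z => 1 - Phi z) mPhiC.
have L2 := @cvg_abinom_integral _ (measurableTypeR R) R leb _ mHalf a
   (fun z => z ^+ i * phi z) Phi mPhiD.
apply: cvgD.
  under eq_fun do under eq_bigr do rewrite sum_binomial_half.
  have -> : \int[leb]_(z in `[0, +oo[) (z ^+ i * phi z * Phi z `^ a) =
     \int[leb]_(z in `[0, +oo[) (z ^+ i * phi z * (1 - (1 - Phi z)) `^ a).
    by apply: eq_Rintegral => z _; rewrite uC.
  apply: L1 => //.
    by move=> z _; have := Phi01 z; lra.
  have := integrable_half (integrable_p i a1); apply: eq_integrable => // z _.
  by rewrite /= uC.
apply: cvgMl_tmp; apply: L2 => //.
  by move=> z _; have := Phi01 z; lra.
exact/integrable_half/integrable_q.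
Qed.

(** Here [(1 - Phi) `^ b] is expanded on the whole line: the powers of [Phi]
    merge with [Phi `^ a]. *)
Lemma cvg_pq_moment_pow (i : nat) a b : -1 < a -> -1 < b ->
  (fun N => \sum_(0 <= j < N) abinom b j * pq_moment i (j%:R + a) 0) @ \oo -->
  pq_moment i a b.
Proof.
move=> a1 b1.
have L := @cvg_abinom_integral _ (measurableTypeR R) R leb _ measurableT b
   (fun z => z ^+ i * phi z * Phi z `^ a) Phi mPhi.
rewrite (_ : (fun N => _) = fun N => \sum_(0 <= j < N) abinom b j *
  \int[leb]_z (z ^+ i * phi z * Phi z `^ a * Phi z ^+ j)); last first.
  apply/funext => N; apply: eq_bigr => j _; congr (_ * _).
  apply: eq_Rintegral => z _; have /andP[p0 _] := Phi01 z.
  have PN : Phi z != 0 by rewrite gt_eqF.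
  rewrite powRr0 mulr1 (addrC j%:R) powRD; last by rewrite PN implybT.
  by rewrite (powR_mulrn _ (ltW p0)) mulrA.
rewrite (_ : pq_moment i a b =
  \int[leb]_z (z ^+ i * phi z * Phi z `^ a * (1 - Phi z) `^ b)); last first.
  by apply: eq_Rintegral => z _; rewrite mulrA.
apply: L.
- by move=> z _; have := Phi01 z; lra.
- exact: integrable_p.
- have := integrable_pq i a1 b1; apply: eq_integrable => // z _.
  by rewrite /= mulrA.
Qed.

End symmetric_expansion.

(** * Moments of the beta generalized normal distribution *)

Section expansion.
Context {R : realType}.
Local Notation leb := (@lebesgue_measure R).
Implicit Types (a b z : R).
Variables (s : R) (s0 : 0 < s).

Definition gn_moment := pq_moment (gn_pdf s) (gn_cdf s).

Lemma cvg_inner_joint i a : -1 < a -> inner_joint s i a @ \oo --> gn_moment i a 0.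
Proof.
move=> a1; have H := cvg_pq_moment (gn_cdf01 s0) (gn_cdfN s0) (gn_pdfN s)
  (measurable_gn_cdf s0) (integrable_gn_weight s0) (i := i) a1.
apply: cvg_trans H; apply: near_eq_cvg; apply: nearW => M.
by rewrite inner_jointE.
Qed.

Lemma cvg_gn_moment (i : nat) a b : -1 < a -> -1 < b ->
  (fun N => \sum_(0 <= j < N) abinom b j * gn_moment i (j%:R + a) 0) @ \oo -->
  gn_moment i a b.
Proof.
exact: (cvg_pq_moment_pow (gn_cdf01 s0) (measurable_gn_cdf s0) (integrable_gn_weight s0)).
Qed.

(** The sum over [i] is finite, so it can be taken out of the series over [j]. *)
Lemma cvg_outer (S : nat -> R -> R^nat) alpha bet mu sigma (n : nat) :
  0 < alpha -> 0 < bet ->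
  (forall i j : nat, S i (j%:R + alpha - 1) @ \oo -->
    gn_moment i (j%:R + alpha - 1) 0) ->
  outer S alpha bet mu sigma n @ \oo -->
  \sum_(0 <= i < n.+1) 'C(n, i)%:R * (sigma / mu) ^+ i *
    gn_moment i (alpha - 1) (bet - 1).
Proof.
move=> alpha0 bet0 cS.
have outerE : outer S alpha bet mu sigma n = fun N =>
    \sum_(0 <= i < n.+1) 'C(n, i)%:R * (sigma / mu) ^+ i *
      \sum_(0 <= j < N) abinom (bet - 1) j * gn_moment i (j%:R + (alpha - 1)) 0.
  apply/funext => N; rewrite /outer.
  under [RHS]eq_bigr do rewrite mulr_sumr.
  rewrite exchange_big/=; apply: eq_bigr => j _; rewrite mulr_sumr.
  apply: eq_bigr => i _; rewrite (cvg_lim (@norm_hausdorff _ _) (cS i j)).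
  by rewrite (addrA j%:R) mulrCA.
rewrite outerE.
elim: n.+1 {outerE} => [|m IH].
  rewrite big_nil (_ : (fun N => _) = cst 0); first exact: cvg_cst.
  by apply/funext => N; rewrite big_nil.
rewrite big_nat_recr//= (_ : (fun N => _) = (fun N =>
    \sum_(0 <= i < m) 'C(n, i)%:R * (sigma / mu) ^+ i *
      \sum_(0 <= j < N) abinom (bet - 1) j * gn_moment i (j%:R + (alpha - 1)) 0 +
    'C(n, m)%:R * (sigma / mu) ^+ m *
      \sum_(0 <= j < N) abinom (bet - 1) j * gn_moment m (j%:R + (alpha - 1)) 0)); last first.
  by apply/funext => N; rewrite big_nat_recr.
apply: cvgD => //; apply: cvgMl_tmp; apply: cvg_gn_moment; lra.
Qed.

Lemma beta_ge0 alpha bet : 0 <= beta alpha bet :> R.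
Proof.
by rewrite /beta /gamma divr_ge0 ?mulr_ge0//; exact: upper_gamma_ge0.
Qed.

Lemma bgn_pdf_ge0 alpha bet mu sigma x : 0 < sigma ->
  0 <= bgn_pdf alpha bet mu sigma s x.
Proof.
move=> sigma0; rewrite /bgn_pdf.
apply: mulr_ge0; last exact: gn_pdf_ge0.
apply: mulr_ge0; last exact: powR_ge0.
apply: mulr_ge0; last exact: powR_ge0.
by rewrite invr_ge0; apply: mulr_ge0; [exact: ltW|exact: beta_ge0].
Qed.

Lemma measurable_bgn_pdf alpha bet mu sigma :
  measurable_fun [set: R] (bgn_pdf alpha bet mu sigma s).
Proof.
have m1 : measurable_fun [set: R] (fun x : R => (x - mu) / sigma).
  by apply: measurable_funM => //; exact: measurable_funB.
have m2 : measurable_fun [set: R] (fun x : R => gn_cdf s ((x - mu) / sigma)).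
  exact: (measurableT_comp (measurable_gn_cdf s0) m1).
have m3 : measurable_fun [set: R] (fun x : R => 1 - gn_cdf s ((x - mu) / sigma)).
  exact: measurable_funB.
apply: measurable_funM;
  last exact: (measurableT_comp (measurable_gn_pdf s) m1).
apply: measurable_funM; last exact: (measurableT_comp (measurable_powR _) m3).
apply: measurable_funM; first exact: measurable_cst.
exact: (measurableT_comp (measurable_powR _) m2).
Qed.

(** The substitution [x = mu + sigma z] standardizes the density, and the
    binomial theorem expands
    [(mu + sigma z) ^+ n = mu ^+ n * (1 + (sigma / mu) z) ^+ n]. *)
Lemma bgn_moment (d : measure_display) (T : measurableType d)
    (P : probability T R) (X : {RV P >-> R}) alpha bet mu sigma (n : nat) :
  0 < alpha -> 0 < bet -> mu != 0 -> 0 < sigma ->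
  has_density X (bgn_pdf alpha bet mu sigma s) ->
  ('E_P[fun w => (X w ^+ n)%R])%E =
  (mu ^+ n / beta alpha bet * \sum_(0 <= i < n.+1) 'C(n, i)%:R *
    (sigma / mu) ^+ i * gn_moment i (alpha - 1) (bet - 1))%:E.
Proof.
move=> alpha0 bet0 mu0 sigma0 Xf.
have sN0 : sigma != 0 by rewrite gt_eqF.
have a1 : -1 < alpha - 1 by lra.
have b1 : -1 < bet - 1 by lra.
pose F x := x ^+ n * bgn_pdf alpha bet mu sigma s x.
have mX : measurable_fun [set: R] (fun x : R => x ^+ n) by exact: exprn_measurable.
have mF : measurable_fun [set: R] F.
  by apply: measurable_funM => //; exact: measurable_bgn_pdf.
pose c i := (sigma * beta alpha bet)^-1 * mu ^+ n * ('C(n, i)%:R * (sigma / mu) ^+ i).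
pose w i z := z ^+ i * gn_pdf s z * (gn_cdf s z `^ (alpha - 1) * (1 - gn_cdf s z) `^ (bet - 1)).
have FE z : F (mu + sigma * z) = \sum_(0 <= i < n.+1) c i * w i z.
  have zE : (mu + sigma * z - mu) / sigma = z.
    by rewrite addrAC subrr add0r mulrAC mulfV ?mul1r.
  rewrite /F /bgn_pdf zE.
  have -> : (mu + sigma * z) ^+ n =
      mu ^+ n * \sum_(0 <= i < n.+1) 'C(n, i)%:R * (sigma / mu) ^+ i * z ^+ i.
    have -> : mu + sigma * z = mu * (1 + sigma / mu * z) by field.
    rewrite exprMn exprDn big_mkord; congr (_ * _); apply: eq_bigr => i _.
    by rewrite expr1n mul1r exprMn -mulr_natl mulrA.
  rewrite mulr_sumr mulr_suml; apply: eq_bigr => i _.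
  rewrite /c /w; ring.
have [iF IF] := Rintegral_lincomb (mu := leb) measurableT n.+1 c
  (fun i => integrable_gn_weight s0 i a1 b1).
have iFz : leb.-integrable [set: R] (fun z => (F (mu + sigma * z))%:E).
  by apply: eq_integrable iF => // z _; rewrite /= FE.
have iF' := integrable_affine sN0 mF iFz.
rewrite (expectation_density Xf
  (fun x => bgn_pdf_ge0 alpha bet mu x sigma0)
  (measurable_bgn_pdf alpha bet mu sigma) mX iF').
rewrite (integral_affine sN0 mF iFz) (gtr0_norm sigma0).
rewrite -[X in (_ * X)%E]fineK; last exact: integrable_fin_num iFz.
rewrite -EFinM; congr EFin.
transitivity (sigma * \int[leb]_z (\sum_(0 <= i < n.+1) c i * w i z)).
  by congr (_ * _); apply: eq_Rintegral => z _; rewrite FE.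
rewrite IF !mulr_sumr; apply: eq_bigr => i _.
have alg (B q x y : R) : sigma * ((sigma * B)^-1 * q * x * y) = q / B * (x * y).
  by rewrite invfM !mulrA mulfV// mul1r (mulrC q).
exact: alg.
Qed.

End expansion.

Theorem proposition1 (R : realType) (d : measure_display)
    (T : measurableType d) (P : probability T R) (X : {RV P >-> R})
    (alpha bet mu sigma s : R) (n : nat)
    (alpha_gt0 : 0 < alpha) (bet_gt0 : 0 < bet) (mu_neq0 : mu != 0)
    (sigma_gt0 : 0 < sigma) (s_gt0 : 0 < s) (n_gt0 : (0 < n)%N)
    (X_bgn : has_density X (bgn_pdf alpha bet mu sigma s)) :
  ((forall j k : nat, cvgn (v_part (j%:R + alpha - 1) k)) ->
     moment_expansion X (inner_iterated s) alpha bet mu sigma n) /\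
  moment_expansion X (inner_joint s) alpha bet mu sigma n.
Proof.
have joint i (j : nat) : inner_joint s i (j%:R + alpha - 1) @ \oo -->
    gn_moment s i (j%:R + alpha - 1) 0.
  apply: cvg_inner_joint => //.
  by have : 0 <= j%:R :> R by []; lra.
have expand S : (forall i j : nat, S i (j%:R + alpha - 1) @ \oo -->
    gn_moment s i (j%:R + alpha - 1) 0) ->
    moment_expansion X S alpha bet mu sigma n.
  move=> cS; have H := @cvg_outer _ _ s_gt0 S _ _ mu sigma n alpha_gt0 bet_gt0 cS.
  split.
  - by move=> i j _; apply: cvgP; exact: cS.
  - exact: cvgP H.
  - rewrite (@bgn_moment _ _ s_gt0 _ _ _ _ _ _ _ _ n alpha_gt0 bet_gt0 mu_neq0
      sigma_gt0 X_bgn).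
    by rewrite (cvg_lim _ H).
split; last exact: expand.
(* the hypothesis forces every exponent to be a natural number *)
move=> cv; apply: expand => i j.
have [N aN] := cvg_v_part_natural (cv j).
have := joint i j; rewrite aN; apply: cvg_trans; apply: near_eq_cvg.
by exists N.+1 => // M /= NM; rewrite inner_iterated_joint.
Qed.
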